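(* Let $k$ be an algebraically closed field of characteristic zero, and let $X\subset\mathbb{P}^4_{x_1,\dots,x_5}$ be the chordal cubic threefold over $k$ given by $$x_1x_4^2+x_2^2x_5-x_1x_3x_5-2x_2x_3x_4+x_3^3=0.$$ Let $G\subset\mathrm{Aut}(X)=\mathrm{PGL}_2$ be a finite subgroup. Then the $G$-action on $X$ is linearizable.
   Context: The chordal cubic is the secant variety of its singular locus, which is a rational normal quartic curve $C\simeq\mathbb{P}^1$ in $\mathbb{P}^4$; its automorphism group is $\mathrm{PGL}_2=\mathrm{PGL}_2(k)$, acting on $\mathbb{P}^4$ via the usual embedding $\mathbb{P}^1=C\hookrightarrow\mathbb{P}^4$. A $G$-action on $\mathbb{P}^n$ is called linear if it arises from the projectivization $\mathbb{P}(V)$ of a $G$-representation $V$. A $G$-action on an $n$-dimensional projective variety $X$ is linearizable if $X$ is $G$-equivariantly birational to $\mathbb{P}^n$ with a linear $G$-action. *)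

(* Defs.v *)
From HB Require Import structures.
From mathcomp Require Import all_boot all_order all_fingroup all_algebra.
From mathcomp Require Import generic_quotient mxrepresentation ring zify.
From mathcomp Require Import mpoly.

Set Implicit Arguments.
Unset Strict Implicit.
Unset Printing Implicit Defensive.

Import GRing.Theory.
Local Open Scope ring_scope.
Local Open Scope quotient_scope.

(* The index n is the dimension of the projective space P^n, so that GL k n   *)
(* is GL_{n+1}(k) and PGL k n is PGL_{n+1}(k); in particular PGL k 1 is PGL_2.*)

Section ProjectiveLinearGroup.
Variables (k : fieldType) (n : nat).

Record GL := MkGL { GLval :> 'M[k]_n.+1; GLunit : GLval \is a GRing.unit }.

HB.instance Definition _ := [isSub for GLval].
HB.instance Definition _ := [Choice of GL by <:].

Definition GL_one := MkGL (@unitr1 'M[k]_n.+1).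

Lemma GL_mul_unit (A B : GL) : GLval A * GLval B \is a GRing.unit.
Proof. by rewrite unitrMl ?GLunit. Qed.
Definition GL_mul (A B : GL) := MkGL (GL_mul_unit A B).

Lemma GL_inv_unit (A : GL) : (GLval A)^-1 \is a GRing.unit.
Proof. by rewrite unitrV GLunit. Qed.
Definition GL_inv (A : GL) := MkGL (GL_inv_unit A).

Definition GL_proj (A B : GL) := is_scalar_mx (GLval A * (GLval B)^-1).

Lemma GL_projP (A B : GL) :
  reflect (exists2 c : k, c != 0 & GLval A = c *: GLval B) (GL_proj A B).
Proof.
apply: (iffP is_scalar_mxP) => [[c Ec]|[c c0 ->]]; exists c.
  have := GLunit A; apply: contraTneq => c0.
  by rewrite -[GLval A](mulrVK (GLunit B)) Ec c0 raddf0 mul0r unitr0.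
  by rewrite -[LHS](mulrVK (GLunit B)) Ec; exact: mul_scalar_mx.
by rewrite -scalerAl mulrV ?GLunit // scalemx1.
Qed.

Lemma GL_proj_equiv : equiv_class_of GL_proj.
Proof.
split=> [A|A B|B A C].
- by apply/GL_projP; exists 1; rewrite ?oner_eq0 // scale1r.
- by apply/GL_projP/GL_projP=> -[c c0 ->]; exists c^-1; rewrite ?invr_eq0 //;
    rewrite scalerK.
- move=> /GL_projP[c c0 EA] /GL_projP[d d0 EB]; apply/GL_projP.
  by exists (c * d); rewrite ?mulf_neq0 // EA EB scalerA.
Qed.

Canonical GL_proj_equivrel := EquivRelPack GL_proj_equiv.

Definition PGL := {eq_quot GL_proj}.
HB.instance Definition _ := Choice.on PGL.
HB.instance Definition _ := EqQuotient.on PGL.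

Lemma PGL_eqP (A B : GL) :
  reflect (exists2 c : k, c != 0 & GLval A = c *: GLval B)
          (\pi_PGL A == \pi_PGL B).
Proof. by rewrite eqmodE; exact: GL_projP. Qed.

Lemma PGL_ind (P : PGL -> Prop) : (forall A, P (\pi_PGL A)) -> forall x, P x.
Proof. by move=> PA x; rewrite -[x]reprK. Qed.

Lemma repr_piP (A : GL) :
  exists2 c : k, c != 0 & GLval (repr (\pi_PGL A)) = c *: GLval A.
Proof. by apply/PGL_eqP; rewrite reprK. Qed.

Definition PGL_one : PGL := \pi_PGL GL_one.
Definition PGL_mul (x y : PGL) : PGL := \pi_PGL (GL_mul (repr x) (repr y)).
Definition PGL_inv (x : PGL) : PGL := \pi_PGL (GL_inv (repr x)).

Lemma pi_PGL_mul (A B : GL) :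
  PGL_mul (\pi_PGL A) (\pi_PGL B) = \pi_PGL (GL_mul A B).
Proof.
have [c c0 EA] := repr_piP A; have [d d0 EB] := repr_piP B.
apply/eqP/PGL_eqP; exists (c * d); rewrite ?mulf_neq0 //=.
by rewrite EA EB -scalerAl -scalerAr scalerA.
Qed.

Lemma pi_PGL_inv (A : GL) : PGL_inv (\pi_PGL A) = \pi_PGL (GL_inv A).
Proof.
have [c c0 EA] := repr_piP A.
apply/eqP/PGL_eqP; exists c^-1; rewrite ?invr_eq0 //=.
by rewrite EA invrZ ?GLunit ?unitfE.
Qed.

Lemma PGL_mulA : associative PGL_mul.
Proof.
elim/PGL_ind=> A; elim/PGL_ind=> B; elim/PGL_ind=> C; rewrite !pi_PGL_mul.
by congr \pi_PGL; apply: val_inj; rewrite /= mulrA.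
Qed.

Lemma PGL_mul1 : left_id PGL_one PGL_mul.
Proof.
elim/PGL_ind=> A; rewrite pi_PGL_mul.
by congr \pi_PGL; apply: val_inj; rewrite /= mul1r.
Qed.

Lemma PGL_mulr1 : right_id PGL_one PGL_mul.
Proof.
elim/PGL_ind=> A; rewrite pi_PGL_mul.
by congr \pi_PGL; apply: val_inj; rewrite /= mulr1.
Qed.

Lemma PGL_mulV : left_inverse PGL_one PGL_inv PGL_mul.
Proof.
elim/PGL_ind=> A; rewrite pi_PGL_inv pi_PGL_mul.
by congr \pi_PGL; apply: val_inj; rewrite /= mulVr ?GLunit.
Qed.

Lemma PGL_mulrV : right_inverse PGL_one PGL_inv PGL_mul.
Proof.
elim/PGL_ind=> A; rewrite pi_PGL_inv pi_PGL_mul.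
by congr \pi_PGL; apply: val_inj; rewrite /= mulrV ?GLunit.
Qed.

HB.instance Definition _ :=
  isGroup.Build PGL PGL_mulA PGL_mul1 PGL_mulr1 PGL_mulV PGL_mulrV.

End ProjectiveLinearGroup.

(* A point of P^n is a nonzero column vector up to scaling, and a locus in   *)
(* P^n is a (scaling invariant) predicate on such vectors.                    *)

Section ProjectiveGeometry.
Variable k : fieldType.

Definition same_point n (x y : 'cV[k]_n.+1) : Prop :=
  x != 0 /\ exists2 c : k, c != 0 & y = c *: x.

Definition projective_space n : {pred 'cV[k]_n.+1} := [pred x | x != 0].

Definition heval n (p : {mpoly k[n.+1]}) (x : 'cV[k]_n.+1) : k :=
  p.@[fun i => x i 0].

Definition hypersurface n (p : {mpoly k[n.+1]}) : {pred 'cV[k]_n.+1} :=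
  [pred x | (x != 0) && (heval p x == 0)].

(* The open subset q <> 0 of X is Zariski dense in X, i.e. it meets every     *)
(* nonempty basic open subset of X.  By prime avoidance, every dense open     *)
(* subset of X contains one of this form, so that generically X P says that P *)
(* holds on some dense open subset of X.                                      *)
Definition dense_open n (X : {pred 'cV[k]_n.+1}) (q : {mpoly k[n.+1]}) : Prop :=
  forall d (p : {mpoly k[n.+1]}), p \is d.-homog ->
    (exists2 x, x \in X & heval p x != 0) ->
  exists2 x, x \in X & (heval p x != 0) && (heval q x != 0).

Definition generically n (X : {pred 'cV[k]_n.+1}) (P : 'cV[k]_n.+1 -> Prop) :=
  exists d (q : {mpoly k[n.+1]}),
    [/\ q \is d.-homog, dense_open X q
      & forall x, x \in X -> heval q x != 0 -> P x].

(* A tuple of forms, viewed as the partially defined map                      *)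
(* x |-> [F_0(x) : ... : F_m(x)], undefined where all the F_i vanish.         *)
Definition forms n m := 'I_m.+1 -> {mpoly k[n.+1]}.

Definition fmap n m (F : forms n m) (x : 'cV[k]_n.+1) : 'cV[k]_m.+1 :=
  \col_i heval (F i) x.

Definition rational_map n m (X : {pred 'cV[k]_n.+1}) (Y : {pred 'cV[k]_m.+1})
    (F : forms n m) : Prop :=
  (exists d, forall i, F i \is d.-homog) /\
  generically X (fun x => fmap F x \in Y).

Definition inverse_birational_maps n m (X : {pred 'cV[k]_n.+1})
    (Y : {pred 'cV[k]_m.+1}) (F : forms n m) (H : forms m n) : Prop :=
  [/\ rational_map X Y F, rational_map Y X H,
      generically X (fun x => same_point (fmap H (fmap F x)) x)
    & generically Y (fun y => same_point (fmap F (fmap H y)) y)].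

Definition equivariantly_birational (gT : Type) n m
    (X : {pred 'cV[k]_n.+1}) (a : gT -> PGL k n)
    (Y : {pred 'cV[k]_m.+1}) (b : gT -> PGL k m) : Prop :=
  exists (F : forms n m) (H : forms m n),
    inverse_birational_maps X Y F H /\
    forall g, generically X (fun x =>
      same_point (fmap F (GLval (repr (a g)) *m x))
                 (GLval (repr (b g)) *m fmap F x)).

End ProjectiveGeometry.

Arguments projective_space : clear implicits.

(* The linear action of a finite group on P(V), V the column space of rG.     *)

Section LinearAction.
Variables (k : fieldType) (gT : finGroupType) (n : nat).
Variable rG : mx_representation k [set: gT] n.+1.

Definition linear_action (g : gT) : PGL k n :=
  \pi_(PGL k n) (MkGL (repr_mx_unitr rG (in_setT g))).

Lemma linear_actionM : {morph linear_action : g h / (g * h)%g}.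
Proof.
move=> g h; rewrite [RHS]pi_PGL_mul; congr \pi_(PGL k n).
by apply: val_inj; rewrite /= repr_mxM ?in_setT.
Qed.

HB.instance Definition _ :=
  isMultiplicative.Build gT (PGL k n) linear_action linear_actionM.

End LinearAction.

(* Here G acts through a on P^n by projective transformations preserving X,   *)
(* and d is the dimension of X.                                               *)
Definition linearizable (k : fieldType) (gT : finGroupType) n d
    (X : {pred 'cV[k]_n.+1}) (a : {multiplicative gT -> PGL k n}) : Prop :=
  exists rG : mx_representation k [set: gT] d.+1,
    equivariantly_birational X a (projective_space k d) (linear_action rG).

(* Row i of sym_mx d A lists the coefficients of                              *)
(* (A_00 s + A_01 t)^(d-i) (A_10 s + A_11 t)^i on the monomials s^(d-j) t^j,  *)
(* dehomogenized at s = 1.  Thus sym_mx d A maps the point of the rational    *)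
(* normal curve with parameter u to the one with parameter A u (see           *)
(* sym_mx_veronese).                                                          *)

Section SymmetricPower.
Variables (k : fieldType).

Definition lform (A : 'M[k]_2) (i : 'I_2) : {poly k} :=
  (A i 0)%:P + A i 1 *: 'X.

Definition sym_mx d (A : 'M[k]_2) : 'M[k]_d.+1 :=
  \matrix_(i, j) (lform A 0 ^+ (d - i) * lform A 1 ^+ i)`_j.

Definition veronese d (u : 'cV[k]_2) : 'cV[k]_d.+1 :=
  \col_j (u 0 0 ^+ (d - j) * u 1 0 ^+ j).

(* Substitution of (x, y) for (s, t) in the homogenization of p in degree m.  *)
Definition hsubst (S : comAlgType k) (x y : S) m (p : {poly k}) : S :=
  \sum_(j < m.+1) p`_j *: (x ^+ (m - j) * y ^+ j).

Section Hsubst.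
Variables (S : comAlgType k) (x y : S).
Local Notation T := (hsubst x y).

Lemma hsubst_sum m I (r : seq I) (F : I -> {poly k}) :
  T m (\sum_(i <- r) F i) = \sum_(i <- r) T m (F i).
Proof.
rewrite /hsubst exchange_big; apply: eq_bigr => j _ /=.
by rewrite coef_sum scaler_suml.
Qed.

Lemma hsubstZ m c p : T m (c *: p) = c *: T m p.
Proof.
by rewrite /hsubst scaler_sumr; apply: eq_bigr => j _; rewrite coefZ scalerA.
Qed.

Lemma hsubstXn m i : (i <= m)%N -> T m 'X^i = x ^+ (m - i) * y ^+ i.
Proof.
move=> le_im; rewrite /hsubst (bigD1 (inord i)) //= coefXn inordK // eqxx.
rewrite scale1r big1 ?addr0 // => j; rewrite -val_eqE /= inordK // coefXn.
by move=> /negPf->; rewrite scale0r.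
Qed.

Lemma hsubstM m n (p q : {poly k}) : (size p <= m.+1)%N -> (size q <= n.+1)%N ->
  T (m + n) (p * q) = T m p * T n q.
Proof.
move=> sp sq.
have Ep : p = \sum_(i < m.+1) p`_i *: 'X^i.
  apply/polyP=> i; rewrite -poly_def coef_poly.
  by case: ltnP => // lt_mi; rewrite nth_default // (leq_trans sp).
have Eq : q = \sum_(i < n.+1) q`_i *: 'X^i.
  apply/polyP=> i; rewrite -poly_def coef_poly.
  by case: ltnP => // lt_mi; rewrite nth_default // (leq_trans sq).
rewrite {1}Ep mulr_suml hsubst_sum [T m p]/hsubst mulr_suml.
apply: eq_bigr => i _; rewrite {1}Eq mulr_sumr hsubst_sum [T n q]/hsubst.
rewrite mulr_sumr; apply: eq_bigr => j _.
have le_im : (i <= m)%N by rewrite -ltnS.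
have le_jn : (j <= n)%N by rewrite -ltnS.
rewrite -!scalerAl -!scalerAr -exprD !hsubstZ hsubstXn ?leq_add //.
have -> : (m + n - (i + j) = (m - i) + (n - j))%N by lia.
by rewrite !exprD mulrACA.
Qed.

Lemma size_lform A i : (size (lform A i) <= 2)%N.
Proof.
rewrite (leq_trans (size_polyD _ _)) // geq_max size_polyC.
by rewrite (leq_trans (leq_b1 _)) // (leq_trans (size_scale_leq _ _)) ?size_polyX.
Qed.

Lemma size_lform_exp A i m : (size (lform A i ^+ m) <= m.+1)%N.
Proof.
rewrite (leq_trans (size_poly_exp_leq _ _)) // ltnS.
by rewrite -[leqRHS]mul1n leq_mul2r -ltnS (leq_trans (leqSpred _)) ?orbT //;
  have := size_lform A i; case: size => // -[|[]].
Qed.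

Lemma hsubst_lform A i : T 1 (lform A i) = A i 0 *: x + A i 1 *: y.
Proof.
rewrite /hsubst !big_ord_recl big_ord0 /= addr0 !coefD !coefC !coefZ !coefX /=.
by rewrite !mulr0 mulr1 !(addr0, add0r) !expr1 !expr0 mulr1 mul1r.
Qed.

Lemma hsubst_lformX A i m :
  T m (lform A i ^+ m) = (A i 0 *: x + A i 1 *: y) ^+ m.
Proof.
elim: m => [|m IHm].
  by rewrite expr0 -[1](expr0 'X) hsubstXn // !expr0 mulr1.
by rewrite !exprS -[m.+1]add1n hsubstM ?size_lform ?size_lform_exp //
  hsubst_lform IHm.
Qed.

Lemma hsubst_row A d i : (i <= d)%N ->
  T d (lform A 0 ^+ (d - i) * lform A 1 ^+ i) =
  (A 0 0 *: x + A 0 1 *: y) ^+ (d - i) * (A 1 0 *: x + A 1 1 *: y) ^+ i.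
Proof.
move=> le_id; rewrite -{1}(subnK le_id) hsubstM ?size_lform_exp //.
by rewrite !hsubst_lformX.
Qed.

End Hsubst.

Lemma sym_mx_veronese d A u :
  sym_mx d A *m veronese d u = veronese d (A *m u).
Proof.
apply/colP=> i; have le_id : (i <= d)%N by rewrite -ltnS.
have E r : (A *m u) r 0 = A r 0 * u 0 0 + A r 1 * u 1 0.
  rewrite !mxE !big_ord_recl !big_ord0 !addr0.
  by congr (_ + A _ _ * u _ _); apply: val_inj.
rewrite [RHS]mxE !E.
rewrite -[RHS](@hsubst_row k^o (u 0 0) (u 1 0) A d i le_id) mxE.
by apply: eq_bigr => j _; rewrite !mxE.
Qed.

Lemma sym_mxM d A B : sym_mx d (A *m B) = sym_mx d A *m sym_mx d B.
Proof.
apply/matrixP=> i j; rewrite !mxE.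
have le_id : (i <= d)%N by rewrite -ltnS.
have := @hsubst_row {poly k} (lform B 0) (lform B 1) A d i le_id.
have E r : A r 0 *: lform B 0 + A r 1 *: lform B 1 = lform (A *m B) r.
  rewrite /lform !mxE !big_ord_recl !big_ord0 !addr0.
  have -> : lift ord0 ord0 = 1 :> 'I_2 by apply: val_inj.
  by rewrite !scalerDr !scalerA addrACA -!mul_polyC -!rmorphM -!rmorphD
     -!mulrDl -rmorphD.
rewrite !E => <-; rewrite /hsubst coef_sum; apply: eq_bigr => l _.
by rewrite coefZ !mxE.
Qed.

Lemma sym_mx1 d : sym_mx d 1%:M = 1%:M.
Proof.
apply/matrixP=> i j; rewrite !mxE /lform !mxE /= scale0r addr0 scale1r add0r.
by rewrite expr1n mul1r coefXn eq_sym.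
Qed.

Lemma sym_mxZ d c A : sym_mx d (c *: A) = c ^+ d *: sym_mx d A.
Proof.
apply/matrixP=> i j; rewrite !mxE.
have le_id : (i <= d)%N by rewrite -ltnS.
have E r : lform (c *: A) r = c *: lform A r.
  by rewrite /lform !mxE scalerDr scalerA -!mul_polyC -!rmorphM.
by rewrite !E !exprZn -scalerAl -scalerAr scalerA -exprD subnK // coefZ.
Qed.

Lemma sym_mx_unit d (A : GL k 1) : sym_mx d A \is a GRing.unit.
Proof.
have: sym_mx d (GLval A)^-1 *m sym_mx d A = 1%:M.
  by rewrite -sym_mxM mulmxE mulVr ?GLunit ?sym_mx1.
by case/mulmx1_unit.
Qed.

(* The morphism PGL_2 -> PGL_{d+1} through which PGL_2 acts on the P^d        *)
(* spanned by the rational normal curve of degree d.                          *)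
Definition sym_PGL d (x : PGL k 1) : PGL k d :=
  \pi_(PGL k d) (MkGL (sym_mx_unit d (repr x))).

Lemma sym_PGL_pi d (A : GL k 1) :
  sym_PGL d (\pi_(PGL k 1) A) = \pi_(PGL k d) (MkGL (sym_mx_unit d A)).
Proof.
have [c c0 EA] := repr_piP A; apply/eqP/PGL_eqP.
by exists (c ^+ d); rewrite ?expf_neq0 //= EA sym_mxZ.
Qed.

Lemma sym_PGLM d : {morph sym_PGL d : x y / (x * y)%g}.
Proof.
elim/PGL_ind=> A; elim/PGL_ind=> B.
rewrite [(_ * _)%g]pi_PGL_mul !sym_PGL_pi [RHS]pi_PGL_mul.
by congr \pi_(PGL k d); apply: val_inj; rewrite /= -mulmxE sym_mxM.
Qed.

HB.instance Definition _ d :=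
  isMultiplicative.Build (PGL k 1) (PGL k d) (sym_PGL d) (@sym_PGLM d).

End SymmetricPower.

Section ChordalCubic.
Variable k : fieldType.

Definition chordal_cubic_poly : {mpoly k[5]} :=
  let x1 := 'X_(inord 0) in
  let x2 := 'X_(inord 1) in
  let x3 := 'X_(inord 2) in
  let x4 := 'X_(inord 3) in
  let x5 := 'X_(inord 4) in
  x1 * x4 ^+ 2 + x2 ^+ 2 * x5 - x1 * x3 * x5 - 2 * x2 * x3 * x4 + x3 ^+ 3.

Definition chordal_cubic : {pred 'cV[k]_5} := hypersurface chordal_cubic_poly.

Definition hankel (x : 'cV[k]_5) : 'M[k]_3 := \matrix_(i, j) x (inord (i + j)) 0.

Lemma chordal_cubic_det x : heval chordal_cubic_poly x = - \det (hankel x).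
Proof.
have e2 (B : 'M[k]_2) : \det B = B 0 0 * B 1 1 - B 0 1 * B 1 0.
  rewrite (expand_det_row _ 0) !big_ord_recl big_ord0 addr0 /cofactor !det_mx11.
  rewrite !mxE /= /bump /= expr0 expr1 mul1r mulN1r mulrN.
  by congr (_ * B _ _ - B _ _ * B _ _); apply: val_inj.
rewrite (expand_det_row _ 0) !big_ord_recl big_ord0 addr0 /cofactor.
rewrite !e2 !mxE /= /bump /= !add0n ?addn0.
rewrite /heval /chordal_cubic_poly.
rewrite !(mevalD, mevalB, mevalN, mevalM, rmorphXn, mevalXU, meval1) /=.
rewrite /bump /= !(addn0, add0n, add1n, addn1) /=.
rewrite -[(2 + 2)%N]/4%N; ring.
Qed.

Lemma hankel_sym (A : 'M[k]_2) x :
  hankel (sym_mx 4 A *m x) = sym_mx 2 A *m hankel x *m (sym_mx 2 A)^T.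
Proof.
pose L (p : {poly k}) : k := \sum_(j < 5) p`_j * x j 0.
have Lsum I (r : seq I) (F : I -> {poly k}) :
    L (\sum_(i <- r) F i) = \sum_(i <- r) L (F i).
  rewrite /L exchange_big; apply: eq_bigr => j _ /=.
  by rewrite coef_sum mulr_suml.
have LZ c p : L (c *: p) = c * L p.
  by rewrite /L mulr_sumr; apply: eq_bigr => j _; rewrite coefZ mulrA.
have LX i : (i <= 4)%N -> L 'X^i = x (inord i) 0.
  move=> le_i4; rewrite /L (bigD1 (inord i)) //= coefXn inordK // eqxx mul1r.
  rewrite big1 ?addr0 // => j; rewrite -val_eqE /= inordK // coefXn.
  by move=> /negPf->; rewrite mul0r.
have E3 (p : {poly k}) : (size p <= 3)%N -> p = \sum_(i < 3) p`_i *: 'X^i.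
  move=> sp; apply/polyP=> i; rewrite -poly_def coef_poly.
  by case: ltnP => // lt_mi; rewrite nth_default // (leq_trans sp).
pose r (i : nat) := lform A 0 ^+ (2 - i) * lform A 1 ^+ i.
have sr i : (i <= 2)%N -> (size (r i) <= 3)%N.
  move=> le_i2; rewrite (leq_trans (size_polyMleq _ _)) //.
  have := size_lform_exp A 0 (2 - i); have := size_lform_exp A 1 i.
  by lia.
apply/matrixP=> i j; have := ltn_ord i; have := ltn_ord j => hj hi.
transitivity (L (r i * r j)).
  rewrite !mxE /L; apply: eq_bigr => l _; rewrite !mxE inordK; last lia.
  congr (_`_ _ * _); rewrite /r mulrACA -!exprD.
  by have -> : (4 - (i + j) = 2 - i + (2 - j))%N by lia.
rewrite [r i]E3 ?sr // [r j]E3 ?sr // mulr_suml Lsum mxE.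
under [RHS]eq_bigr do rewrite !mxE mulr_suml.
rewrite [RHS]exchange_big; apply: eq_bigr => a _ /=.
rewrite mulr_sumr Lsum; apply: eq_bigr => b _.
rewrite -scalerAl -scalerAr -exprD !LZ LX; last first.
  by have := ltn_ord a; have := ltn_ord b; lia.
by rewrite !mxE; ring.
Qed.

(* The action of PGL_2 on P^4 through sym_PGL 4 preserves the chordal cubic.  *)
Lemma chordal_cubic_stable (g : PGL k 1) x : x \in chordal_cubic ->
  GLval (repr (sym_PGL 4 g)) *m x \in chordal_cubic.
Proof.
move=> /andP[x0 /eqP Xx]; have [c c0 ->] := repr_piP (MkGL (sym_mx_unit 4 (repr g))).
rewrite /= -scalemxAl; set y := _ *m x.
have y0 : y != 0.
  apply: contraNneq x0 => y0; rewrite -[x](mulKmx (sym_mx_unit 4 (repr g))).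
  by rewrite -/y y0 mulmx0.
have hy : hankel (c *: y) = c *: hankel y by apply/matrixP=> i j; rewrite !mxE.
rewrite inE scaler_eq0 negb_or c0 y0 /= chordal_cubic_det hy detZ hankel_sym.
move: Xx; rewrite chordal_cubic_det !det_mulmx => /eqP; rewrite oppr_eq0.
by move=> /eqP->; rewrite mulr0 mul0r mulr0 oppr0.
Qed.

End ChordalCubic.

Arguments chordal_cubic : clear implicits.

(* Main.v *)
Require Import Defs.
From mathcomp Require Import all_boot all_order all_fingroup all_algebra.
From mathcomp Require Import generic_quotient mxrepresentation mpoly ring.
Import Defs.

(** Write [E v] for the space of the [x] with [hankel x *m v = 0], where [v] is
    read as a binary quadratic form.  For [v <> 0] it has dimension 2, and for
    [v] with distinct roots its projectivization is the line spanned by the two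
    points of the rational normal quartic at these roots.  The chordal cubic is
    the locus where the Hankel matrix is singular, hence the union of the
    [E v] for [v <> 0]; a general point [x] lies in exactly one of them, namely
    for [v = kervec x].  So the cubic is birational to the projectivization of a
    bundle of planes over the projective plane, and PGL_2 acts on this bundle by
    genuine (not only projective) representations: [quartic_mx] on quartic
    coordinates and [dual_conic_mx] on the base ([quartic_mx_ker]).

    The action of the finite group on the base is faithful
    ([dual_conic_mx_faithful]), so the bundle is generically trivial as an
    equivariant bundle.  Concretely, averaging over the group a section that
    vanishes on the orbit of some [v0], except at [v0] itself, yields
    equivariant polynomial sections of the [E v] with a prescribed value at
    [v0].  This produces two generically independent equivariant sections [s1]
    and [s2] whose degrees differ by exactly one ([equivariant_sections]).
    Then [(t, v) |-> t s1(v) + s2(v)] is given by forms of one degree and is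
    equivariant for the linear action on the projectivization of the trivial
    representation plus the 3-dimensional one.  It is birational onto the cubic:
    from [x] one recovers [v = kervec x], and then [t] from the coordinates of
    [x] in the basis [s1 v, s2 v] of [E v] ([coparamK], [paramK],
    [coparam_equivariant]).

    These identities hold where certain forms are nonzero.  That such loci are
    dense comes from the irreducibility of the cubic
    ([irreducible_chordal_cubic]): it is the closure of the image of a
    polynomial map defined on an affine space. *)

Set Implicit Arguments.
Unset Strict Implicit.
Unset Printing Implicit Defensive.

Import GRing.Theory.
Local Open Scope ring_scope.
Local Open Scope quotient_scope.

(** * Homogeneous forms *)

Section Forms.
Variables (k : closedFieldType) (n : nat).
Implicit Types (f g : 'cV[k]_n.+1 -> k) (x y : 'cV[k]_n.+1).

(** Forms are handled through the functions they define, so that substitution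
    is composition of functions and identities between values are proved by
    ring computations in [k]. *)
Definition is_form d f : Prop :=
  exists2 p : {mpoly k[n.+1]}, p \is d.-homog & forall x, heval p x = f x.

Lemma is_form_ext d f g : f =1 g -> is_form d f -> is_form d g.
Proof. by move=> fg [p hp E]; exists p => // x; rewrite E fg. Qed.

Lemma is_form_const c : is_form 0 (fun=> c).
Proof.
exists c%:MP => [|x]; last by rewrite /heval mevalC.
by rewrite -[c]mulr1 mpolyCM mul_mpolyC; apply: dhomogZ; exact: dhomog1.
Qed.

Lemma is_form0 d : is_form d (fun=> 0).
Proof. by exists 0; [exact: dhomog0 | move=> x; rewrite /heval meval0]. Qed.

Lemma is_form_coord i : is_form 1 (fun x => x i 0).
Proof.
exists 'X_i => [|x]; last by rewrite /heval mevalXU.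
by rewrite dhomogX /= mdeg1.
Qed.

Lemma is_formD d f g : is_form d f -> is_form d g ->
  is_form d (fun x => f x + g x).
Proof.
move=> [p hp Ep] [q hq Eq]; exists (p + q) => [|x].
  exact: dhomogD.
by rewrite -Ep -Eq /heval mevalD.
Qed.

Lemma is_formM d e f g : is_form d f -> is_form e g ->
  is_form (d + e) (fun x => f x * g x).
Proof.
move=> [p hp Ep] [q hq Eq]; exists (p * q) => [|x].
  exact: dhomogM.
by rewrite -Ep -Eq /heval mevalM.
Qed.

Lemma is_formZ d c f : is_form d f -> is_form d (fun x => c * f x).
Proof. by move=> hf; have := is_formM (is_form_const c) hf. Qed.

Lemma is_formN d f : is_form d f -> is_form d (fun x => - f x).
Proof.
by move/(is_formZ (-1)); apply: is_form_ext => x; rewrite mulN1r.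
Qed.

Lemma is_formB d f g : is_form d f -> is_form d g ->
  is_form d (fun x => f x - g x).
Proof. by move=> hf /is_formN; exact: is_formD. Qed.

Lemma is_form_sum d I (r : seq I) (P : pred I) (F : I -> 'cV[k]_n.+1 -> k) :
  (forall i, is_form d (F i)) -> is_form d (fun x => \sum_(i <- r | P i) F i x).
Proof.
move=> hF; elim: r => [|i r IHr].
  by apply: is_form_ext (is_form0 d) => x; rewrite big_nil.
case Pi: (P i); last by apply: is_form_ext IHr => x; rewrite big_cons Pi.
by apply: is_form_ext (is_formD (hF i) IHr) => x; rewrite big_cons Pi.
Qed.

Lemma is_form_prod I (r : seq I) (P : pred I) (d : I -> nat)
    (F : I -> 'cV[k]_n.+1 -> k) :
  (forall i, P i -> is_form (d i) (F i)) ->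
  is_form (\sum_(i <- r | P i) d i) (fun x => \prod_(i <- r | P i) F i x).
Proof.
move=> hF; elim: r => [|i r IHr].
  by rewrite big_nil; apply: is_form_ext (is_form_const 1) => x; rewrite big_nil.
rewrite big_cons; case: ifP => Pi.
  by apply: is_form_ext (is_formM (hF i Pi) IHr) => x; rewrite big_cons Pi.
by apply: is_form_ext IHr => x; rewrite big_cons Pi.
Qed.

Lemma is_formX d m f : is_form d f -> is_form (m * d) (fun x => f x ^+ m).
Proof.
move=> hf; elim: m => [|m IHm].
  by apply: is_form_ext (is_form_const 1) => x; rewrite expr0.
by apply: is_form_ext (is_formM hf IHm) => x; rewrite exprS.
Qed.

Lemma is_form_homog d f c x : is_form d f -> f (c *: x) = c ^+ d * f x.
Proof.
move=> [p /dhomogP hp E]; rewrite -!E /heval !mevalE mulr_sumr.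
apply: eq_big_seq => m /hp <-.
rewrite mulrCA /=; congr (_ * _).
rewrite mdegE -prodrXr -big_split; apply: eq_bigr => i _ /=.
by rewrite mxE exprMn.
Qed.

(** Restricting both forms to the line through [x] and [y] gives two nonzero
    polynomials in one variable, and [k] is infinite. *)
Lemma is_form_meet d e f g x y : is_form d f -> is_form e g ->
  f x != 0 -> g y != 0 -> exists z, (f z != 0) && (g z != 0).
Proof.
pose line := fun i => (x i 0)%:P + (y i 0 - x i 0) *: 'X : {poly k}.
pose r (p : {mpoly k[n.+1]}) := mmap (@polyC k) line p.
have Er p t : (r p).[t] = heval p (x + t *: (y - x)).
  rewrite /r /heval /mmap mevalE horner_sum; apply: eq_bigr => m _.
  rewrite hornerM hornerC; congr (_ * _); rewrite /mmap1 horner_prod.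
  apply: eq_bigr => i _; rewrite horner_exp; congr (_ ^+ _).
  by rewrite /line hornerD hornerC hornerZ hornerX !mxE mulrC.
move=> [p _ Ep] [q _ Eq] fx gy.
have rq : r p * r q != 0.
  rewrite mulf_neq0 //.
    apply: contraNneq fx => r0; rewrite -Ep -[x]addr0 -(scale0r (y - x)) -Er.
    by rewrite r0 horner0.
  apply: contraNneq gy => r0; rewrite -Eq -[y](subrK x) addrC.
  by rewrite -[y - x]scale1r -Er r0 horner0.
have [t] := closed_nonrootP _ rq; rewrite /root hornerM mulf_eq0 negb_or.
by rewrite !Er Ep Eq; exists (x + t *: (y - x)).
Qed.

End Forms.

Section VectorForms.
Variable k : closedFieldType.

Definition is_vform n m d (F : 'cV[k]_n.+1 -> 'cV[k]_m.+1) : Prop :=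
  forall i, is_form d (fun x => F x i 0).

Lemma is_form_comp n m d e f (F : 'cV[k]_n.+1 -> 'cV[k]_m.+1) :
  is_form d f -> is_vform e F -> is_form (d * e) (fun x => f (F x)).
Proof.
move=> [p /dhomogP hp E] hF.
have: is_form (d * e) (fun x =>
    \sum_(m <- msupp p) p@_m * \prod_i F x i 0 ^+ m i); last first.
  by apply: is_form_ext => x; rewrite -E /heval mevalE.
elim: (msupp p) hp => [|q r IHr] hp.
  by apply: is_form_ext (is_form0 _ _ _) => x; rewrite big_nil.
have hq : is_form (d * e) (fun x => p@_q * \prod_i F x i 0 ^+ q i).
  have /= <- := hp q (mem_head _ _); apply: is_formZ.
  rewrite mdegE big_distrl; apply: is_form_prod => i _.
  exact: is_formX.
apply: is_form_ext (is_formD hq (IHr _)) => [x|q' hq']; first by rewrite big_cons.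
by apply: hp; rewrite inE hq' orbT.
Qed.

Lemma is_vform_comp n m l d e (G : 'cV[k]_m.+1 -> 'cV[k]_l.+1)
    (F : 'cV[k]_n.+1 -> 'cV[k]_m.+1) :
  is_vform d G -> is_vform e F -> is_vform (d * e) (fun x => G (F x)).
Proof. by move=> hG hF i; exact: is_form_comp (hG i) hF. Qed.

Lemma is_vform_homog n m d (F : 'cV[k]_n.+1 -> 'cV[k]_m.+1) c x :
  is_vform d F -> F (c *: x) = c ^+ d *: F x.
Proof. by move=> hF; apply/colP=> i; rewrite mxE (is_form_homog c x (hF i)). Qed.

Lemma is_vform_mulmx n m l d (A : 'M[k]_(l.+1, m.+1))
    (F : 'cV[k]_n.+1 -> 'cV[k]_m.+1) :
  is_vform d F -> is_vform d (fun x => A *m F x).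
Proof.
move=> hF i.
apply: (@is_form_ext _ _ _ (fun x => \sum_j A i j * F x j 0)) => [x|].
  by rewrite mxE.
by apply: is_form_sum => j; apply: is_formZ; exact: hF.
Qed.

Lemma is_vform_id n : is_vform 1 (fun x : 'cV[k]_n.+1 => x).
Proof. by move=> i; exact: is_form_coord. Qed.

Lemma is_vformZ n m d e f (F : 'cV[k]_n.+1 -> 'cV[k]_m.+1) :
  is_form d f -> is_vform e F -> is_vform (d + e) (fun x => f x *: F x).
Proof.
by move=> hf hF i; apply: is_form_ext (is_formM hf (hF i)) => x; rewrite mxE.
Qed.

Lemma is_vformD n m d (F G : 'cV[k]_n.+1 -> 'cV[k]_m.+1) :
  is_vform d F -> is_vform d G -> is_vform d (fun x => F x + G x).
Proof.
by move=> hF hG i; apply: is_form_ext (is_formD (hF i) (hG i)) => x; rewrite mxE.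
Qed.

Lemma is_vform_sum n m d I (r : seq I) (F : I -> 'cV[k]_n.+1 -> 'cV[k]_m.+1) :
  (forall i, is_vform d (F i)) -> is_vform d (fun x => \sum_(i <- r) F i x).
Proof.
move=> hF j; apply: is_form_ext (is_form_sum r xpredT (fun i => hF i j)) => x.
by rewrite summxE.
Qed.

Lemma vform_forms n m d (F : 'cV[k]_n.+1 -> 'cV[k]_m.+1) : is_vform d F ->
  exists2 P : forms k n m, forall i, P i \is d.-homog & fmap P =1 F.
Proof.
move=> hF.
have [P hP] := fin_all_exists2 hF.
by exists P => // x; apply/colP=> i; rewrite mxE.
Qed.

End VectorForms.

(** * Irreducible cones *)

Section Generic.
Variable k : closedFieldType.

(** Irreducibility tested on forms: two nonempty basic open subsets meet. *)
Definition irreducible_cone n (X : {pred 'cV[k]_n.+1}) : Prop :=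
  forall d e (f g : 'cV[k]_n.+1 -> k) x y, is_form d f -> is_form e g ->
    x \in X -> f x != 0 -> y \in X -> g y != 0 ->
  exists2 z, z \in X & (f z != 0) && (g z != 0).

Lemma generically_irreducible n (X : {pred 'cV[k]_n.+1}) d f x
    (P : 'cV[k]_n.+1 -> Prop) : irreducible_cone X ->
  is_form d f -> x \in X -> f x != 0 ->
  (forall y, y \in X -> f y != 0 -> P y) -> generically X P.
Proof.
move=> irrX [q hq Eq] Xx fx hP; exists d, q; split=> // [e p hp [y Xy py]|y Xy].
  apply: (irrX e d _ _ y x) => //; [by exists p | by exists q | by rewrite Eq].
by rewrite Eq; exact: hP.
Qed.

(** Multiplying by a coordinate keeps the common point away from the origin. *)
Lemma irreducible_punctured n (C : 'cV[k]_n.+1 -> Prop)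
    (X : {pred 'cV[k]_n.+1}) :
    (forall x, reflect (x != 0 /\ C x) (x \in X)) ->
    (forall d e (f g : 'cV[k]_n.+1 -> k) x y, is_form d f -> is_form e g ->
      C x -> f x != 0 -> C y -> g y != 0 ->
      exists2 z, C z & (f z != 0) && (g z != 0)) ->
  irreducible_cone X.
Proof.
move=> XP irrC d e f g x y hf hg /XP[x0 Cx] fx /XP[_ Cy] gy.
have [i xi] : exists i, x i 0 != 0 by apply/cV0Pn.
have [|z Cz] := irrC _ _ _ g x y (is_formM hf (is_form_coord k i)) hg Cx _ Cy gy.
  by rewrite mulf_neq0.
rewrite mulf_eq0 negb_or -andbA => /and3P[fz zi gz].
exists z; last by rewrite fz gz.
by apply/XP; split=> //; apply: contraNneq zi => ->; rewrite mxE.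
Qed.

Lemma irreducible_projective_space n : irreducible_cone (projective_space k n).
Proof.
apply: (@irreducible_punctured _ (fun=> True)) => [x|].
  by apply: (iffP idP) => [|[]].
move=> d e f g x y hf hg _ fx _ gy.
by have [z fgz] := is_form_meet hf hg fx gy; exists z.
Qed.

End Generic.

(** * Secant lines of the rational normal quartic *)

Section SecantLines.
Variable k : closedFieldType.
Implicit Types (x : 'cV[k]_5) (v : 'cV[k]_3).

(** Indexing by natural numbers makes the indices of Hankel matrices add. *)
Definition hcoord n (x : 'cV[k]_n.+1) i := x (inord i) 0.

Lemma is_form_hcoord n i : is_form 1 (fun x : 'cV[k]_n.+1 => hcoord x i).
Proof. exact: is_form_coord. Qed.

Lemma hcoordP n (x y : 'cV[k]_n.+1) :
  (forall i, (i <= n)%N -> hcoord x i = hcoord y i) -> x = y.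
Proof.
move=> xy; apply/colP=> i; have := xy i; rewrite /hcoord inord_val; apply.
by rewrite -ltnS.
Qed.

Lemma hcoordZ n c (x : 'cV[k]_n.+1) i : hcoord (c *: x) i = c * hcoord x i.
Proof. by rewrite /hcoord mxE. Qed.

Lemma hcoordD n (x y : 'cV[k]_n.+1) i :
  hcoord (x + y) i = hcoord x i + hcoord y i.
Proof. by rewrite /hcoord mxE. Qed.

Lemma hcoordB n (x y : 'cV[k]_n.+1) i :
  hcoord (x - y) i = hcoord x i - hcoord y i.
Proof. by rewrite /hcoord !mxE. Qed.

Lemma hcoord0 n i : hcoord (0 : 'cV[k]_n.+1) i = 0.
Proof. by rewrite /hcoord mxE. Qed.

Lemma hcoord_neq0 n (y : 'cV[k]_n.+1) i : hcoord y i != 0 -> y != 0.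
Proof. by apply: contraNneq => ->; rewrite hcoord0. Qed.

Definition vec n (s : seq k) : 'cV[k]_n.+1 := \col_i s`_i.

Lemma hcoord_vec n s i : (i <= n)%N -> hcoord (vec n s) i = s`_i.
Proof. by move=> le_in; rewrite /hcoord mxE inordK. Qed.

Lemma hankel_kerP x v :
  hankel x *m v = 0 <->
  forall i, (i <= 2)%N ->
    hcoord x i * hcoord v 0 + hcoord x i.+1 * hcoord v 1 +
    hcoord x i.+2 * hcoord v 2 = 0.
Proof.
have E i : (i <= 2)%N -> hcoord (hankel x *m v) i =
    hcoord x i * hcoord v 0 + hcoord x i.+1 * hcoord v 1 +
    hcoord x i.+2 * hcoord v 2.
  move=> le_i2; rewrite /hcoord mxE !big_ord_recl big_ord0 !mxE !inordK //=.
  rewrite /bump /= !(addn0, addn1, add0n, addn2) addr0 !addrA.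
  have -> : inord 0 = ord0 :> 'I_3 by apply: val_inj; rewrite /= inordK.
  have -> : inord 1 = lift ord0 ord0 :> 'I_3 by apply: val_inj; rewrite /= inordK.
  by have -> : inord 2 = lift ord0 (lift ord0 ord0) :> 'I_3
    by apply: val_inj; rewrite /= inordK.
split=> [H i le_i2|H]; first by rewrite -E // H hcoord0.
by apply: hcoordP => i le_i2; rewrite E // H // hcoord0.
Qed.

Lemma hankel_kerE x v : hankel x *m v = 0 ->
  [/\ hcoord x 0 * hcoord v 0 + hcoord x 1 * hcoord v 1 + hcoord x 2 * hcoord v 2 = 0,
      hcoord x 1 * hcoord v 0 + hcoord x 2 * hcoord v 1 + hcoord x 3 * hcoord v 2 = 0
    & hcoord x 2 * hcoord v 0 + hcoord x 3 * hcoord v 1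
      + hcoord x 4 * hcoord v 2 = 0].
Proof. by move/hankel_kerP=> H; split; exact: H. Qed.

Lemma hankel_ker_intro x v :
  hcoord x 0 * hcoord v 0 + hcoord x 1 * hcoord v 1 + hcoord x 2 * hcoord v 2 = 0 ->
  hcoord x 1 * hcoord v 0 + hcoord x 2 * hcoord v 1 + hcoord x 3 * hcoord v 2 = 0 ->
  hcoord x 2 * hcoord v 0 + hcoord x 3 * hcoord v 1 + hcoord x 4 * hcoord v 2 = 0 ->
  hankel x *m v = 0.
Proof. by move=> E0 E1 E2; apply/hankel_kerP => -[|[|[|]]]. Qed.

Lemma hankel_kerD x y v : hankel x *m v = 0 -> hankel y *m v = 0 ->
  hankel (x + y) *m v = 0.
Proof.
have -> : hankel (x + y) = hankel x + hankel y by apply/matrixP=> i j; rewrite !mxE.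
by rewrite mulmxDl => -> ->; rewrite addr0.
Qed.

Lemma hankelZ c x : hankel (c *: x) = c *: hankel x.
Proof. by apply/matrixP=> i j; rewrite !mxE. Qed.

Lemma hankel_kerZ c x v : hankel x *m v = 0 -> hankel (c *: x) *m v = 0.
Proof. by move=> Hx; rewrite hankelZ -scalemxAl Hx scaler0. Qed.

Lemma hankel_ker_sum I (r : seq I) (F : I -> 'cV[k]_5) v :
  (forall i, hankel (F i) *m v = 0) -> hankel (\sum_(i <- r) F i) *m v = 0.
Proof.
move=> HF; elim/big_ind: _ => // [|x y]; last exact: hankel_kerD.
by rewrite -(scale0r (0 : 'cV_5)) hankelZ scale0r mul0mx.
Qed.

Lemma chordal_cubicP x :
  reflect (x != 0 /\ exists2 v : 'cV_3, v != 0 & hankel x *m v = 0)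
          (x \in chordal_cubic k).
Proof.
have hT : (hankel x)^T = hankel x by apply/matrixP=> i j; rewrite !mxE addnC.
rewrite inE chordal_cubic_det oppr_eq0.
apply: (iffP andP) => -[x0 H]; split=> //.
  case/det0P: H => v v0 Hv; exists v^T; last by rewrite -hT -trmx_mul Hv trmx0.
  by rewrite -trmx0 (inj_eq trmx_inj).
case: H => v v0 Hv; apply/det0P; exists v^T; last by rewrite -hT -trmx_mul Hv trmx0.
by rewrite -trmx0 (inj_eq trmx_inj).
Qed.

(** The cross product of the first two rows of the Hankel matrix: where it is
    nonzero it spans the kernel of these rows. *)
Definition kervec x : 'cV[k]_3 :=
  vec 2 [:: hcoord x 1 * hcoord x 3 - hcoord x 2 * hcoord x 2;
            hcoord x 1 * hcoord x 2 - hcoord x 0 * hcoord x 3;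
            hcoord x 0 * hcoord x 2 - hcoord x 1 * hcoord x 1].

Lemma is_vform_vec n m d (F : 'cV[k]_n.+1 -> seq k) :
  (forall i, (i <= m)%N -> is_form d (fun y => (F y)`_i)) ->
  is_vform d (fun y => vec m (F y)).
Proof.
by move=> hF i; apply: is_form_ext (hF i _) => [y|]; rewrite ?mxE // -ltnS.
Qed.

Lemma is_vform_kervec : is_vform 2 kervec.
Proof.
apply: is_vform_vec => -[|[|[|]]] // _; rewrite /=;
  apply: is_formB; exact: (is_formM (is_form_hcoord _ _) (is_form_hcoord _ _)).
Qed.

(** The entries are combinations of the first two equations [hankel x *m v = 0],
    with entries of [x] as coefficients. *)
Lemma kervecE x v : hankel x *m v = 0 ->
  hcoord (kervec x) 2 *: v = hcoord v 2 *: kervec x.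
Proof.
move/hankel_kerE=> [E0 E1 _]; apply: hcoordP => i le_i2; rewrite !hcoordZ.
rewrite /kervec !hcoord_vec //.
case: i le_i2 => [|[|[|]]] // _ /=; apply/eqP; rewrite -subr_eq0; apply/eqP.
- transitivity (hcoord x 2 * 0 - hcoord x 1 * 0 : k); last by ring.
  by rewrite -{1}E0 -E1; ring.
- transitivity (hcoord x 0 * 0 - hcoord x 1 * 0 : k); last by ring.
  by rewrite -{1}E1 -E0; ring.
- by ring.
Qed.

Lemma kervec_colinear x v : hankel x *m v = 0 -> hcoord v 2 != 0 ->
  kervec x = (hcoord (kervec x) 2 / hcoord v 2) *: v.
Proof.
move=> Hx v2; rewrite mulrC -scalerA (kervecE Hx) scalerA mulVf // scale1r //.
Qed.

(** Some nonzero [v] is in the kernel, and [kervec x] is proportional to it. *)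
Lemma kervec_ker x : x \in chordal_cubic k -> hcoord (kervec x) 2 != 0 ->
  hankel x *m kervec x = 0.
Proof.
move=> /chordal_cubicP[_ [v v0 Hv]] w0.
have Ev := kervecE Hv; have v2 : hcoord v 2 != 0.
  apply: contraNneq v0 => v2; move: Ev; rewrite v2 scale0r => /eqP.
  by rewrite scaler_eq0 (negPf w0).
by apply: (scalerI v2); rewrite scaler0 scalemxAr -Ev -scalemxAr Hv scaler0.
Qed.

(** When the last entry of [v] is nonzero, [hankel x *m v = 0] is a linear
    recurrence of order 2 on the entries of [x], determined by two of them. *)
Lemma secant_ext v x y : hcoord v 2 != 0 ->
  hankel x *m v = 0 -> hankel y *m v = 0 ->
  hcoord x 0 = hcoord y 0 -> hcoord x 1 = hcoord y 1 -> x = y.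
Proof.
move=> v2 Hx Hy e0 e1.
have Hz : hankel (x - y) *m v = 0.
  by apply: hankel_kerD => //; rewrite -scaleN1r; exact: hankel_kerZ.
have z0 : hcoord (x - y) 0 = 0 by rewrite hcoordB e0 subrr.
have z1 : hcoord (x - y) 1 = 0 by rewrite hcoordB e1 subrr.
apply/eqP; rewrite -subr_eq0; apply/eqP.
have [E0 E1 E2] := hankel_kerE Hz.
have cancel2 (a : k) : a * hcoord v 2 = 0 -> a = 0.
  by move/eqP; rewrite mulf_eq0 (negPf v2) orbF => /eqP.
move: E0; rewrite z0 z1 !mul0r !add0r => /cancel2 z2.
move: E1; rewrite z2 z1 !mul0r !add0r => /cancel2 z3.
move: E2; rewrite z2 z3 !mul0r !add0r => /cancel2 z4.
by apply: hcoordP => i le_i4; rewrite hcoord0; move: i le_i4 => [|[|[|[|[|i]]]]].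
Qed.

(** The solution of the recurrence with initial values [a] and [b], multiplied by
    [v2 ^+ 3] to clear the denominators. *)
Definition secant_seq (v0 v1 v2 a b : k) : seq k :=
  let c2 := - (v0 * a + v1 * b) in
  let c3 := - (v0 * (v2 * b) + v1 * c2) in
  [:: v2 ^+ 3 * a; v2 ^+ 3 * b; v2 ^+ 2 * c2; v2 * c3;
      - (v0 * (v2 * c2) + v1 * c3)].

Definition secant_point v (a b : k) : 'cV[k]_5 :=
  vec 4 (secant_seq (hcoord v 0) (hcoord v 1) (hcoord v 2) a b).

Lemma secant_point_ker v a b : hankel (secant_point v a b) *m v = 0.
Proof. by apply: hankel_ker_intro; rewrite /secant_point !hcoord_vec //=; ring. Qed.

Lemma secant_point_hcoord v x : hankel x *m v = 0 ->
  secant_point v (hcoord x 0) (hcoord x 1) = hcoord v 2 ^+ 3 *: x.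
Proof.
move/hankel_kerE=> [E0 E1 E2].
have E0' : hcoord x 2 * hcoord v 2 =
    - (hcoord v 0 * hcoord x 0 + hcoord v 1 * hcoord x 1).
  by apply/eqP; rewrite -subr_eq0 -E0; apply/eqP; ring.
have E1' : hcoord x 3 * hcoord v 2 =
    - (hcoord v 0 * hcoord x 1 + hcoord v 1 * hcoord x 2).
  by apply/eqP; rewrite -subr_eq0 -E1; apply/eqP; ring.
have E2' : hcoord x 4 * hcoord v 2 =
    - (hcoord v 0 * hcoord x 2 + hcoord v 1 * hcoord x 3).
  by apply/eqP; rewrite -subr_eq0 -E2; apply/eqP; ring.
apply: hcoordP => i le_i4; rewrite hcoordZ hcoord_vec // /secant_seq -E0'.
move: i le_i4 => [|[|[|[|[|i]]]]] // _ /=; first by ring.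
- have -> : - (hcoord v 0 * (hcoord v 2 * hcoord x 1) +
    hcoord v 1 * (hcoord x 2 * hcoord v 2)) = hcoord v 2 * (hcoord x 3 * hcoord v 2).
    by rewrite E1'; ring.
  by ring.
- have -> : - (hcoord v 0 * (hcoord v 2 * hcoord x 1) +
    hcoord v 1 * (hcoord x 2 * hcoord v 2)) = hcoord v 2 * (hcoord x 3 * hcoord v 2).
    by rewrite E1'; ring.
  transitivity (hcoord v 2 ^+ 2 * (hcoord x 4 * hcoord v 2)); last by ring.
  by rewrite E2'; ring.
Qed.

Lemma hcoord_secant_point0 v a b :
  hcoord (secant_point v a b) 0 = hcoord v 2 ^+ 3 * a.
Proof. by rewrite hcoord_vec. Qed.

Lemma hcoord_secant_point1 v a b :
  hcoord (secant_point v a b) 1 = hcoord v 2 ^+ 3 * b.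
Proof. by rewrite hcoord_vec. Qed.

Lemma is_vform_secant_seq n e (v0 v1 v2 a b : 'cV[k]_n.+1 -> k) :
    is_form 1 v0 -> is_form 1 v1 -> is_form 1 v2 -> is_form e a -> is_form e b ->
  is_vform (3 + e) (fun z => vec 4 (secant_seq (v0 z) (v1 z) (v2 z) (a z) (b z))).
Proof.
move=> h0 h1 h2 ha hb.
pose c2 z := - (v0 z * a z + v1 z * b z).
have hc2 : is_form (1 + e) c2 by apply: is_formN; apply: is_formD; exact: is_formM.
pose c3 z := - (v0 z * (v2 z * b z) + v1 z * c2 z).
have hc3 : is_form (1 + (1 + e)) c3.
  by apply: is_formN; apply: is_formD; apply: is_formM => //; exact: is_formM.
apply: is_vform_vec => -[|[|[|[|[|i]]]]] // _ /=.
- exact: (is_formM (is_formX 3 h2)).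
- exact: (is_formM (is_formX 3 h2)).
- exact: (is_formM (is_formX 2 h2) hc2).
- exact: (is_formM h2 hc3).
- apply: is_formN; apply: is_formD; last exact: (is_formM h1 hc3).
  exact: (is_formM h0 (is_formM h2 hc2)).
Qed.

Lemma is_vform_secant_point a b : is_vform 3 (fun v => secant_point v a b).
Proof.
have hc i : is_form 1 (fun v => hcoord v i) by exact: is_form_hcoord.
exact: (is_vform_secant_seq (hc 0) (hc 1) (hc 2)
  (is_form_const 2 a) (is_form_const 2 b)).
Qed.

(** All the secant points with [v] and the initial values as coordinates: a
    polynomial map whose image is dense in the cone over the cubic. *)
Definition secant_chart (z : 'cV[k]_5) : 'cV[k]_5 :=
  vec 4 (secant_seq (hcoord z 0) (hcoord z 1) (hcoord z 2)
                    (hcoord z 3) (hcoord z 4)).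

Lemma is_vform_secant_chart : is_vform 4 secant_chart.
Proof.
have hc i : is_form 1 (fun z : 'cV[k]_5 => hcoord z i) by exact: is_form_hcoord.
exact: (is_vform_secant_seq (hc 0) (hc 1) (hc 2) (hc 3) (hc 4)).
Qed.

Lemma secant_pointE v a b :
  secant_point v a b =
  secant_chart (vec 4 [:: hcoord v 0; hcoord v 1; hcoord v 2; a; b]).
Proof. by rewrite /secant_chart !hcoord_vec. Qed.

Lemma secant_chart_ker z :
  hankel (secant_chart z) *m vec 2 [:: hcoord z 0; hcoord z 1; hcoord z 2] = 0.
Proof.
have -> : secant_chart z =
    secant_point (vec 2 [:: hcoord z 0; hcoord z 1; hcoord z 2])
      (hcoord z 3) (hcoord z 4).
  by rewrite /secant_point !hcoord_vec.
exact: secant_point_ker.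
Qed.

Definition rev_vec n (x : 'cV[k]_n.+1) : 'cV[k]_n.+1 := \col_i hcoord x (n - i).

Lemma hcoord_rev_vec n (x : 'cV[k]_n.+1) i : (i <= n)%N ->
  hcoord (rev_vec x) i = hcoord x (n - i).
Proof. by move=> le_in; rewrite {1}/hcoord mxE inordK. Qed.

Lemma is_vform_rev_vec n : is_vform 1 (@rev_vec n).
Proof.
by move=> i; apply: is_form_ext (is_form_hcoord n (n - i)) => x; rewrite mxE.
Qed.

Lemma rev_vecK n : involutive (@rev_vec n).
Proof.
by move=> x; apply: hcoordP => i le_in; rewrite !hcoord_rev_vec ?leq_subr // subKn.
Qed.

(** The symmetry exchanging the two variables of binary forms. *)
Lemma hankel_rev_vec x v :
  hankel x *m v = 0 -> hankel (rev_vec x) *m rev_vec v = 0.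
Proof.
move/hankel_kerE=> [E0 E1 E2].
by apply: hankel_ker_intro; rewrite !hcoord_rev_vec //;
   [rewrite -E2|rewrite -E1|rewrite -E0];
   rewrite /subn /=; ring.
Qed.

Definition secant_cone x : Prop :=
  exists2 v : 'cV_3, v != 0 & hankel x *m v = 0.

Lemma secant_chart_nonroot d f x v : is_form d f -> hankel x *m v = 0 ->
  hcoord v 2 != 0 -> f x != 0 -> exists z, f (secant_chart z) != 0.
Proof.
move=> hf Hx v2 fx.
exists (vec 4 [:: hcoord v 0; hcoord v 1; hcoord v 2; hcoord x 0; hcoord x 1]).
rewrite -secant_pointE secant_point_hcoord // (is_form_homog _ _ hf).
by rewrite mulf_neq0 // !expf_neq0.
Qed.

(** The image of [secant_chart] contains, up to scaling, the points whose kernel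
    vector [v] has a nonzero last entry.  Any other point [x] is the value at a
    zero of a coordinate [z_j] of a polynomial map whose values have such a
    kernel vector as soon as [z_j <> 0]; a form that does not vanish at [x] then
    does not vanish at some point with [z_j <> 0]. *)
Lemma secant_cone_dense d f x : is_form d f -> secant_cone x -> f x != 0 ->
  exists z, f (secant_chart z) != 0.
Proof.
move=> hf [v v0 Hx] fx.
have [v2|v2] := eqVneq (hcoord v 2) 0; last exact: secant_chart_nonroot hf Hx v2 fx.
have [v0'|v0'] := eqVneq (hcoord v 0) 0.
  (* Here v is (0, v1, 0), so that x is (x0, 0, 0, 0, x4); delta z lies on the *)
  (* secant line of (0, z0, z1), and is x at z = (1, 0, x0, x4).              *)
  pose delta (z : 'cV[k]_5) := vec 4 [:: hcoord z 0 ^+ 3 * hcoord z 2;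
    - (hcoord z 1 ^+ 3 * hcoord z 3); hcoord z 1 ^+ 2 * hcoord z 0 * hcoord z 3;
    - (hcoord z 1 * hcoord z 0 ^+ 2 * hcoord z 3); hcoord z 0 ^+ 3 * hcoord z 3].
  have hdelta : is_vform 4 delta.
    have hc j : is_form 1 (fun x : 'cV[k]_5 => hcoord x j) by exact: is_form_hcoord.
    apply: is_vform_vec => -[|[|[|[|[|i]]]]] // _ /=.
    - exact: (is_formM (is_formX 3 (hc 0)) (hc 2)).
    - exact: (is_formN (is_formM (is_formX 3 (hc 1)) (hc 3))).
    - exact: (is_formM (is_formM (is_formX 2 (hc 1)) (hc 0)) (hc 3)).
    - exact: (is_formN (is_formM (is_formM (hc 1) (is_formX 2 (hc 0))) (hc 3))).
    - exact: (is_formM (is_formX 3 (hc 0)) (hc 3)).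
  have v1 : hcoord v 1 != 0.
    apply: contraNneq v0 => v1; apply/eqP/hcoordP => i le_i2; rewrite hcoord0.
    by move: i le_i2 => [|[|[|i]]].
  have Ex : delta (vec 4 [:: 1; 0; hcoord x 0; hcoord x 4; 0]) = x.
    have [E0 E1 E2] := hankel_kerE Hx.
    move: E0 E1 E2; rewrite v0' v2 !mulr0 !add0r !addr0.
    move=> /eqP; rewrite mulf_eq0 (negPf v1) orbF => /eqP x1.
    move=> /eqP; rewrite mulf_eq0 (negPf v1) orbF => /eqP x2.
    move=> /eqP; rewrite mulf_eq0 (negPf v1) orbF => /eqP x3.
    apply: hcoordP => i le_i4; rewrite /delta !hcoord_vec //=.
    by move: i le_i4 => [|[|[|[|[|i]]]]] // _ /=; rewrite ?x1 ?x2 ?x3; ring.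
  have [z /andP[fz z1]] : exists z, (f (delta z) != 0) && (hcoord z 1 != 0).
    apply: (is_form_meet (is_form_comp hf hdelta) (is_form_hcoord 4 1)
      (x := vec 4 [:: 1; 0; hcoord x 0; hcoord x 4; 0]) (y := vec 4 [:: 0; 1])).
      by rewrite Ex.
    by rewrite hcoord_vec ?oner_neq0.
  apply: (secant_chart_nonroot (v := vec 2 [:: 0; hcoord z 0; hcoord z 1]) hf _ _ fz).
    by apply: hankel_ker_intro; rewrite !hcoord_vec //=; ring.
  by rewrite hcoord_vec.
(* The recurrence is solved downwards from x4 and x3, with denominator v0. *)
have [z /andP[fz z0]] :
    exists z, (f (rev_vec (secant_chart z)) != 0) && (hcoord z 0 != 0).
  apply: (is_form_meet
    (x := vec 4 [:: hcoord v 2; hcoord v 1; hcoord v 0; hcoord x 4; hcoord x 3])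
    (y := vec 4 [:: 1])
    (is_form_comp hf (is_vform_comp (@is_vform_rev_vec 4) is_vform_secant_chart))
     (is_form_hcoord 4 0)).
    have := secant_point_hcoord (hankel_rev_vec Hx).
    rewrite secant_pointE !hcoord_rev_vec // !subn0 => ->.
    rewrite (is_form_homog _ _ (is_form_comp hf (@is_vform_rev_vec 4))) rev_vecK.
    by rewrite mulf_neq0 // !expf_neq0.
  by rewrite hcoord_vec ?oner_neq0.
apply: (secant_chart_nonroot hf (hankel_rev_vec (secant_chart_ker z)) _ fz).
by rewrite hcoord_rev_vec // hcoord_vec.
Qed.

Lemma irreducible_chordal_cubic : irreducible_cone (chordal_cubic k).
Proof.
apply: (@irreducible_punctured _ _ secant_cone) =>
  [x|d e f g x y hf hg Cx fx Cy gy].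
  exact: chordal_cubicP.
have [zf hzf] := secant_cone_dense hf Cx fx.
have [zg hzg] := secant_cone_dense hg Cy gy.
have [z fgz] := is_form_meet (is_form_comp hf is_vform_secant_chart)
  (is_form_comp hg is_vform_secant_chart) hzf hzg.
exists (secant_chart z) => //; have [z2|z2] := eqVneq (hcoord z 2) 0; last first.
  exists (vec 2 [:: hcoord z 0; hcoord z 1; hcoord z 2]).
    by apply: (@hcoord_neq0 _ _ 2); rewrite hcoord_vec.
  exact: secant_chart_ker.
(* When z2 = 0 the first four entries of the secant point vanish. *)
exists (vec 2 [:: 1]).
  by apply: (@hcoord_neq0 _ _ 0); rewrite hcoord_vec ?oner_neq0.
by apply: hankel_ker_intro;
   rewrite /secant_chart /secant_seq z2 !hcoord_vec //=; ring.
Qed.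

End SecantLines.

Section Wedge.
Variable k : closedFieldType.
Implicit Types x y : 'cV[k]_5.

(** On [E v], for [v] with a nonzero last entry, the first two entries are linear
    coordinates, and [wedge] is a volume form. *)
Definition wedge x y := hcoord x 0 * hcoord y 1 - hcoord x 1 * hcoord y 0.

Lemma wedgexx x : wedge x x = 0.
Proof. by rewrite /wedge mulrC subrr. Qed.

Lemma wedgeC x y : wedge x y = - wedge y x.
Proof. by rewrite /wedge; ring. Qed.

Lemma wedgeDl x y z : wedge (x + y) z = wedge x z + wedge y z.
Proof. by rewrite /wedge !hcoordD; ring. Qed.

Lemma wedgeZl c x y : wedge (c *: x) y = c * wedge x y.
Proof. by rewrite /wedge !hcoordZ; ring. Qed.

Lemma wedgeZr c x y : wedge x (c *: y) = c * wedge x y.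
Proof. by rewrite /wedge !hcoordZ; ring. Qed.

Lemma is_form_wedge n d e (F H : 'cV[k]_n.+1 -> 'cV[k]_5) :
  is_vform d F -> is_vform e H -> is_form (d + e) (fun z => wedge (F z) (H z)).
Proof. by move=> hF hH; apply: is_formB; exact: (is_formM (hF _) (hH _)). Qed.

(** Cramer's rule in the plane [E v]. *)
Lemma secant_line_basis v x y z : hcoord v 2 != 0 ->
  hankel x *m v = 0 -> hankel y *m v = 0 -> hankel z *m v = 0 ->
  wedge y z *: x = wedge x z *: y + wedge y x *: z.
Proof.
move=> v2 Hx Hy Hz; apply: (secant_ext v2).
- exact: hankel_kerZ.
- by apply: hankel_kerD; exact: hankel_kerZ.
- by rewrite hcoordD !hcoordZ /wedge; ring.
- by rewrite hcoordD !hcoordZ /wedge; ring.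
Qed.

End Wedge.

(** * Lifting to linear representations *)

Lemma PGL_morph1 (k : fieldType) (G : finGroupType)
  (i : {multiplicative G -> PGL k 1}) : i 1%g = PGL_one k 1.
Proof. by apply: (mulgI (i 1%g)); rewrite -gmulfM mulg1 [RHS]mulg1. Qed.

Section ProjectiveToLinear.
Variables (k : fieldType) (n : nat).
Variable phi : 'M[k]_2 -> 'M[k]_n.
Hypothesis phi1 : phi 1 = 1%:M.
Hypothesis phiM : forall A B : GL k 1, phi (GLval A * GLval B) = phi A *m phi B.
Hypothesis phiZ : forall (c : k) (A : GL k 1), c != 0 -> phi (c *: GLval A) = phi A.

Variables (G : finGroupType) (i : {multiplicative G -> PGL k 1}).

Definition lift_mx (g : G) : 'M[k]_n := phi (repr (i g)).

Lemma lift_mx_pi (A : GL k 1) : phi (repr (\pi_(PGL k 1) A)) = phi A.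
Proof. by have [c c0 ->] := repr_piP A; rewrite phiZ. Qed.

Lemma lift_mx_repr : mx_repr [set: G] lift_mx.
Proof.
split=> [|g h _ _]; rewrite /lift_mx; last by rewrite gmulfM lift_mx_pi phiM.
by rewrite PGL_morph1 lift_mx_pi phi1.
Qed.

Definition lift_repr := MxRepresentation lift_mx_repr.

End ProjectiveToLinear.

Section QuadricsQuartics.
Variable k : closedFieldType.
Implicit Types (A : 'M[k]_2) (c : k).

(** The powers of the determinant make these matrices independent of the
    representative of the class of [A] in PGL_2. *)
Definition quartic_mx A : 'M[k]_5 := (\det A ^- 2) *: sym_mx 4 A.

(** Since [hankel] is transformed by [sym_mx 2 A] as a quadratic form, its kernel
    is transformed by the inverse transpose. *)
Definition dual_conic_mx A : 'M[k]_3 := \det A *: (sym_mx 2 A^-1)^T.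

Lemma quartic_mx1 : quartic_mx 1 = 1%:M.
Proof. by rewrite /quartic_mx det1 expr1n invr1 scale1r sym_mx1. Qed.

Lemma quartic_mxM (A B : GL k 1) :
  quartic_mx (GLval A * GLval B) = quartic_mx A *m quartic_mx B.
Proof.
rewrite /quartic_mx det_mulmx sym_mxM exprMn invfM.
by rewrite -scalemxAl -scalemxAr scalerA.
Qed.

Lemma quartic_mxZ c (A : GL k 1) :
  c != 0 -> quartic_mx (c *: GLval A) = quartic_mx A.
Proof.
move=> c0; rewrite /quartic_mx detZ sym_mxZ scalerA; congr (_ *: _).
by rewrite exprMn invfM -exprM mulrAC mulVf ?expf_neq0 // mul1r.
Qed.

Lemma dual_conic_mx1 : dual_conic_mx 1 = 1%:M.
Proof. by rewrite /dual_conic_mx det1 scale1r invr1 sym_mx1 trmx1. Qed.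

Lemma dual_conic_mxM (A B : GL k 1) :
  dual_conic_mx (GLval A * GLval B) = dual_conic_mx A *m dual_conic_mx B.
Proof.
rewrite /dual_conic_mx det_mulmx invrM ?GLunit // sym_mxM trmx_mul.
by rewrite -scalemxAl -scalemxAr scalerA.
Qed.

Lemma dual_conic_mxZ c (A : GL k 1) :
  c != 0 -> dual_conic_mx (c *: GLval A) = dual_conic_mx A.
Proof.
move=> c0; rewrite /dual_conic_mx detZ invrZ ?GLunit ?unitfE // sym_mxZ.
rewrite linearZ scalerA; congr (_ *: _).
by rewrite mulrAC -exprMn divff // expr1n mul1r.
Qed.

(** The action on the cubic maps [E v] to [E w], where [w] is the image of [v]
    under the action on the base. *)
Lemma quartic_mx_ker (A : GL k 1) x (v : 'cV_3) : hankel x *m v = 0 ->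
  hankel (quartic_mx A *m x) *m (dual_conic_mx A *m v) = 0.
Proof.
move=> Hx.
have U : (sym_mx 2 A)^T *m (sym_mx 2 (GLval A)^-1)^T = 1%:M.
  by rewrite -trmx_mul -sym_mxM mulmxE mulVr ?GLunit // sym_mx1 trmx1.
rewrite -scalemxAl hankelZ hankel_sym /dual_conic_mx -!scalemxAl -scalemxAr.
by rewrite -!mulmxA (mulmxA _^T) U mul1mx Hx mulmx0 !scaler0.
Qed.

(** Evaluating on the conic at the parameters [0], [infinity] and [1] suffices. *)
Lemma sym_mx2_scalar A : is_scalar_mx (sym_mx 2 A) -> is_scalar_mx A.
Proof.
case/is_scalar_mxP=> c Ec.
pose u (a b : k) : 'cV[k]_2 := \col_i (if i == 0 then a else b).
have E a b : let p := A 0 0 * a + A 0 1 * b in let q := A 1 0 * a + A 1 1 * b in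
    [/\ p ^+ 2 = c * a ^+ 2, p * q = c * (a * b) & q ^+ 2 = c * b ^+ 2].
  have := sym_mx_veronese 2 A (u a b); rewrite Ec mul_scalar_mx => /colP H p q.
  have Ep : (A *m u a b) 0 0 = p.
    rewrite mxE !big_ord_recl big_ord0 !mxE /= addr0.
    by congr (_ + A _ _ * _); apply: val_inj.
  have Eq : (A *m u a b) 1 0 = q.
    rewrite mxE !big_ord_recl big_ord0 !mxE /= addr0.
    by congr (_ + A _ _ * _); apply: val_inj.
  have {}H j : (j <= 2)%N -> c * (a ^+ (2 - j) * b ^+ j) = p ^+ (2 - j) * q ^+ j.
    have V w : veronese 2 w (inord j) 0 =
        w 0 0 ^+ (2 - @inord 2 j) * w 1 0 ^+ @inord 2 j by rewrite mxE.
    by move=> le_j2; have := H (inord j); rewrite mxE !V Ep Eq !mxE inordK.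
  by split; [have := H 0 isT|have := H 1 isT|have := H 2 isT];
     rewrite ?mulr1 ?mul1r => ->.
have [/= a1 b1 d1] := E 1 0; have [/= a2 b2 d2] := E 0 1.
have [/= a3 b3 d3] := E 1 1.
move: a1 b1 d1 a2 b2 d2 a3 b3 d3.
rewrite !(mulr0, mulr1, addr0, add0r, expr1n).
rewrite [0 ^+ 2]expr0n !mulr0 => aa _ /eqP.
rewrite sqrf_eq0 => /eqP c0 /eqP.
rewrite sqrf_eq0 => /eqP b0 _ dd.
rewrite c0 b0 addr0 add0r => _ ad _.
have Ead : A 0 0 = A 1 1.
  have [z|nz] := eqVneq (A 0 0) 0; last by apply: (mulfI nz); rewrite ad -aa.
  by apply/esym/eqP; rewrite z -sqrf_eq0 dd -aa z expr0n.
apply/is_scalar_mxP; exists (A 0 0); apply/matrixP=> i j; rewrite !mxE.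
have ord2 (l : 'I_2) : l = 0 \/ l = 1.
  by case: l => [[|[|]]] // H; [left|right]; apply: val_inj.
by case: (ord2 i) => ->; case: (ord2 j) => ->; rewrite /= ?b0 ?c0 ?mulr1n ?mulr0n.
Qed.

Lemma dual_conic_mx_faithful (A : GL k 1) :
  is_scalar_mx (dual_conic_mx A) -> \pi_(PGL k 1) A = PGL_one k 1.
Proof.
have dA : \det A != 0 by rewrite -unitfE; exact: (GLunit A).
case/is_scalar_mxP=> c Ec.
have : is_scalar_mx (sym_mx 2 (GLval A)^-1).
  apply/is_scalar_mxP; exists ((\det A)^-1 * c).
  by rewrite -[LHS]trmxK -[X in X^T](scalerK dA) -/(dual_conic_mx A) Ec
       linearZ /= tr_scalar_mx scale_scalar_mx.
case/sym_mx2_scalar/is_scalar_mxP=> d Ed; apply/eqP/PGL_eqP.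
have uA := GLunit A.
have d0 : d != 0.
  by apply: contraTneq uA => d0; rewrite -unitrV Ed d0 raddf0 unitr0.
exists d^-1; rewrite ?invr_eq0 //=.
by rewrite -[GLval A]invrK Ed -scalemx1 invrZ ?unitr1 ?unitfE // invr1.
Qed.

End QuadricsQuartics.

(** * Averaging over the group *)

Section Minors.
Variables (k : closedFieldType) (n : nat).
Implicit Types x y : 'cV[k]_n.+1.

Definition minor (p : 'I_n.+1 * 'I_n.+1) x y :=
  x p.1 0 * y p.2 0 - x p.2 0 * y p.1 0.

Lemma minor_diag p x : minor p x x = 0.
Proof. by rewrite /minor mulrC subrr. Qed.

Lemma is_form_minor m d e p (F G : 'cV[k]_m.+1 -> 'cV[k]_n.+1) :
  is_vform d F -> is_vform e G -> is_form (d + e) (fun z => minor p (F z) (G z)).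
Proof.
by move=> hF hG; apply: is_formB; exact: (is_formM (hF _) (hG _)).
Qed.

(** If all the vectors [e_a] and [e_a + e_b] are eigenvectors, the matrix is
    scalar. *)
Lemma nonscalar_moves (M : 'M[k]_n.+1) : ~~ is_scalar_mx M ->
  exists p x, minor p x (M *m x) != 0.
Proof.
move=> nsM.
have [[a b] /= /andP[ab Mab]|D] :=
  pickP (fun p : 'I_n.+1 * 'I_n.+1 => (p.1 != p.2) && (M p.1 p.2 != 0)).
  exists (b, a), (delta_mx b 0); rewrite /minor -colE !mxE !eqxx (negPf ab) /=.
  by rewrite mul0r subr0 mul1r.
have D0 a b : a != b -> M a b = 0.
  by move=> ab; have := D (a, b); rewrite /= ab /=; case: eqP.
have [a Ma|E] := pickP (fun a => M a a != M 0 0); last first.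
  case/negP: nsM; apply/is_scalar_mxP; exists (M 0 0); apply/matrixP=> a b.
  rewrite mxE; have [<-|/D0 //] := eqVneq a b.
  by have := E a; case: eqP.
have a0 : a != 0 by apply: contraNneq Ma => ->.
exists (0, a), (delta_mx 0 0 + delta_mx a 0).
rewrite /minor mulmxDr -!colE !mxE !eqxx (negPf a0) (eq_sym 0) (negPf a0) /=.
have a0' : 0 != a by rewrite eq_sym.
rewrite !(D0 a 0) // (D0 0 a) // !(add0r, addr0) !mul1r.
by rewrite subr_eq0.
Qed.

Lemma is_form_meet_all I (r : seq I) (P : pred I) (d : I -> nat)
    (F : I -> 'cV[k]_n.+1 -> k) :
  (forall i, P i -> is_form (d i) (F i)) ->
  (forall i, P i -> exists x, F i x != 0) ->
  exists x, \prod_(i <- r | P i) F i x != 0.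
Proof.
move=> hF F0; elim: r => [|i r [x IHr]].
  by exists 0; rewrite big_nil oner_neq0.
case Pi: (P i); last by exists x; rewrite big_cons Pi.
have [y Fy] := F0 i Pi.
have [z] := is_form_meet (hF i Pi) (is_form_prod r hF) Fy IHr.
by exists z; rewrite big_cons Pi mulf_eq0 negb_or.
Qed.

End Minors.

Section Averaging.
Variables (k : closedFieldType) (G : finGroupType) (m n : nat).
Variables (rho : mx_representation k [set: G] m.+1)
  (sigma : mx_representation k [set: G] n.+1).
Implicit Types (v : 'cV[k]_m.+1) (F : 'cV[k]_m.+1 -> 'cV[k]_n.+1).

(** The projection of maps onto equivariant ones, without the factor
    [#|G|^-1]. *)
Definition average F v := \sum_g sigma g^-1%g *m F (rho g *m v).

Lemma average_equivariant F h v :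
  average F (rho h *m v) = sigma h *m average F v.
Proof.
rewrite /average mulmx_sumr [RHS](reindex_inj (mulIg h)) /=.
apply: eq_bigr => g _; rewrite !mulmxA -!repr_mxM ?in_setT // invMg.
by rewrite mulgA mulgV mul1g.
Qed.

Lemma is_vform_average d F : is_vform d F -> is_vform d (average F).
Proof.
move=> hF; apply: is_vform_sum => g; apply: is_vform_mulmx.
rewrite -[d]muln1; apply: is_vform_comp hF _.
by apply: is_vform_mulmx; exact: is_vform_id.
Qed.

Lemma average_id F v :
  (forall g, g != 1%g -> F (rho g *m v) = 0) -> average F v = F v.
Proof.
move=> F0; rewrite /average (bigD1 1%g) //= big1 => [|g g1].
  by rewrite addr0 invg1 !repr_mx1 !mul1mx.
by rewrite F0 // mulmx0.
Qed.

Hypothesis rho_faithful : forall g, g != 1%g -> ~~ is_scalar_mx (rho g).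

(** A general [v] is moved, as a point of projective space, by every nontrivial
    element of the group.  Each point [rho g *m v] then lies on a hyperplane
    avoiding [v], and [f] is the product of equations of these hyperplanes.
    The form [l] prescribes one more open condition on [v]. *)
Lemma isolating_form d (l : 'cV[k]_m.+1 -> k) x :
    is_form d l -> l x != 0 ->
  exists e f v, [/\ is_form e f, l v != 0, f v != 0
    & forall g, g != 1%g -> f (rho g *m v) = 0].
Proof.
move=> hl lx.
have hrho g : is_vform 1 (fun v => rho g *m v).
  by apply: is_vform_mulmx; exact: is_vform_id.
have [p hp] : exists p : G -> 'I_m.+1 * 'I_m.+1,
    forall g, g != 1%g -> exists v, minor (p g) v (rho g *m v) != 0.
  apply: (fin_all_exists (P := fun g q =>
    g != 1%g -> exists v, minor q v (rho g *m v) != 0)) => g.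
  have [-> |g1] := eqVneq g 1%g; first by exists (0, 0).
  by have [q hq] := nonscalar_moves (rho_faithful g1); exists q.
have hm g : is_form 2 (fun v => minor (p g) v (rho g *m v)).
  exact: (is_form_minor (p g) (@is_vform_id k m) (hrho g)).
have [y hy] := is_form_meet_all (index_enum G) (fun g _ => hm g) hp.
have [v /andP[lv hv]] := is_form_meet hl
  (is_form_prod (index_enum G) (fun g (_ : g != 1%g) => hm g)) lx hy.
pose f w := \prod_(g | g != 1%g) minor (p g) w (rho g *m v).
have hc g : is_form 1 (fun w => minor (p g) w (rho g *m v)).
  apply: (is_form_minor (p g) (d := 1) (e := 0)) => [|i]; first exact: is_vform_id.
  exact: is_form_const.
exists (\sum_(g : G | g != 1%g) 1)%N, f, v; split=> //.
  exact: is_form_prod.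
by move=> g g1; rewrite /f (bigD1 g) //= minor_diag mul0r.
Qed.

End Averaging.

(** * The equivariant parametrization *)

Section Birational.
Variables (k : closedFieldType) (G : finGroupType).
Variables (rho : mx_representation k [set: G] 3).
Variables (sigma : mx_representation k [set: G] 5).
Hypothesis rho_faithful : forall g, g != 1%g -> ~~ is_scalar_mx (rho g).
Hypothesis rho_sigma : forall g x (v : 'cV_3),
  hankel x *m v = 0 -> hankel (sigma g *m x) *m (rho g *m v) = 0.

(** The averaged sections [f v *: secant_point v 1 0] and
    [f v *: secant_point v 0 1] keep their values at the point isolated by [f],
    where they are independent.  The last entry of [v], which is nonzero there,
    is the extra factor that makes the degrees differ by one. *)
Lemma equivariant_sections : exists d s1 s2 v0,
  [/\ is_vform d s1 /\ is_vform d.+1 s2,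
      forall g v, s1 (rho g *m v) = sigma g *m s1 v /\
                  s2 (rho g *m v) = sigma g *m s2 v,
      forall v, hankel (s1 v) *m v = 0 /\ hankel (s2 v) *m v = 0,
      hcoord v0 2 != 0 /\ hcoord (s2 v0) 0 = 0
    & hcoord (s1 v0) 0 * hcoord (s2 v0) 1 != 0].
Proof.
have hl := is_form_hcoord k 2 2.
have [|e [f [v0 [hf v2 fv fg]]]] :=
    isolating_form rho_faithful (x := vec 2 [:: 0; 0; 1]) hl.
  by rewrite hcoord_vec ?oner_neq0.
pose F1 v := f v *: secant_point v 1 0.
pose F2 v := f v *: (hcoord v 2 *: secant_point v 0 1).
have ker_average (F : 'cV[k]_3 -> 'cV[k]_5) v :
    (forall w, hankel (F w) *m w = 0) -> hankel (average rho sigma F v) *m v = 0.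
  move=> HF; apply: hankel_ker_sum => g.
  have := rho_sigma g^-1%g (HF (rho g *m v)).
  by rewrite mulmxA -repr_mxM ?in_setT // mulVg repr_mx1 mul1mx.
have E1 : average rho sigma F1 v0 = F1 v0.
  by apply: average_id => g g1; rewrite /F1 fg // scale0r.
have E2 : average rho sigma F2 v0 = F2 v0.
  by apply: average_id => g g1; rewrite /F2 fg // scale0r.
exists (e + 3)%N, (average rho sigma F1), (average rho sigma F2), v0; split.
- split; apply: is_vform_average.
    exact: (is_vformZ hf (is_vform_secant_point _ _)).
  rewrite -addnS; exact: (is_vformZ hf (is_vformZ hl (is_vform_secant_point _ _))).
- by move=> g v; rewrite !average_equivariant.
- move=> v; split; apply: ker_average => w; do ?apply: hankel_kerZ;
  exact: secant_point_ker.
- by rewrite v2 E2 !hcoordZ hcoord_secant_point0; split=> //; ring.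
- rewrite E1 E2 !hcoordZ hcoord_secant_point0 hcoord_secant_point1 !mulr1.
  by rewrite !mulf_neq0 // expf_neq0.
Qed.

Definition ext_mx (g : G) : 'M[k]_(1 + 3) := block_mx 1%:M 0 0 (rho g).

Lemma ext_mx_repr : mx_repr [set: G] ext_mx.
Proof.
split=> [|g h _ _]; first by rewrite /ext_mx repr_mx1 -scalar_mx_block.
rewrite /ext_mx repr_mxM ?in_setT // mulmx_block.
by rewrite !(mul0mx, mulmx0, mul1mx, addr0, add0r).
Qed.

Definition ext_repr : mx_representation k [set: G] 4 :=
  MxRepresentation ext_mx_repr.

Lemma ext_reprE g (t : 'M_1) (v : 'cV_3) :
  ext_repr g *m col_mx t v = col_mx t (rho g *m v).
Proof.
have: ext_mx g *m col_mx t v = col_mx t (rho g *m v).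
  by rewrite mul_block_col !(mul0mx, mul1mx, addr0, add0r).
exact.
Qed.

Variables (d : nat) (s1 s2 : 'cV[k]_3 -> 'cV[k]_5).
Hypotheses (hs1 : is_vform d s1) (hs2 : is_vform d.+1 s2).
Hypothesis s1_eqv : forall g v, s1 (rho g *m v) = sigma g *m s1 v.
Hypothesis s2_eqv : forall g v, s2 (rho g *m v) = sigma g *m s2 v.
Hypothesis s1_ker : forall v, hankel (s1 v) *m v = 0.
Hypothesis s2_ker : forall v, hankel (s2 v) *m v = 0.

(** Coordinates are [(t, v)] with [t] of degree 1, which balances the degrees [d]
    and [d.+1] of the two sections. *)
Definition param (y : 'cV[k]_(1 + 3)) : 'cV[k]_5 :=
  y 0 0 *: s1 (dsubmx y) + s2 (dsubmx y).

(** By Cramer's rule [x] is proportional to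
    [wedge x (s2 v) *: s1 v - wedge x (s1 v) *: s2 v], so that
    [t = - wedge x (s2 v) / wedge x (s1 v)]; the common denominator is moved to
    the coordinates [v]. *)
Definition coparam (x : 'cV[k]_5) : 'cV[k]_(1 + 3) :=
  let v := kervec x in
  col_mx (- wedge x (s2 v))%:M (wedge x (s1 v) *: v).

(** Where this form is nonzero, [dsubmx y] is the kernel vector of the Hankel
    matrix of [param y], up to scaling, and the two sections are independent
    there. *)
Definition P3_good (y : 'cV[k]_(1 + 3)) : k :=
  hcoord (dsubmx y) 2 * wedge (s1 (dsubmx y)) (s2 (dsubmx y)) *
  hcoord (kervec (param y)) 2.

Definition X_good (x : 'cV[k]_5) : k :=
  hcoord (kervec x) 2 * wedge (s1 (kervec x)) (s2 (kervec x)) *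
  wedge x (s1 (kervec x)).

Lemma is_vform_dsubmx : is_vform 1 (fun y : 'cV[k]_(1 + 3) => dsubmx y).
Proof.
by move=> i; apply: is_form_ext (is_form_coord k (n := 3) (rshift 1 i)) => y;
   rewrite mxE.
Qed.

Lemma is_vform_param : is_vform (1 + d) param.
Proof.
apply: is_vformD.
  apply: is_vformZ; first exact: (is_form_coord k (n := 3)).
  by rewrite -[d]muln1; exact: is_vform_comp hs1 is_vform_dsubmx.
by rewrite -[(1 + d)%N]muln1; exact: is_vform_comp hs2 is_vform_dsubmx.
Qed.

Lemma is_vform_coparam : is_vform (1 + d * 2 + 2) coparam.
Proof.
have hk := @is_vform_kervec k.
have h1 := is_form_wedge (@is_vform_id k 4) (is_vform_comp hs1 hk).
have h2 := is_form_wedge (@is_vform_id k 4) (is_vform_comp hs2 hk).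
have E (x : 'cV[k]_5) j : coparam x (lshift 3 j) 0 = - wedge x (s2 (kervec x)).
  by rewrite /coparam col_mxEu mxE ord1 eqxx mulr1n.
have E' (x : 'cV[k]_5) j :
    coparam x (rshift 1 j) 0 = (wedge x (s1 (kervec x)) *: kervec x) j 0.
  by rewrite /coparam col_mxEd.
move=> i; have [j ->|j ->] := split_ordP (i : 'I_(1 + 3)).
  apply: is_form_ext (fun x => esym (E x j)) _.
  have -> : (1 + d * 2 + 2 = 1 + d.+1 * 2)%N by rewrite mulSn addnCA addnC.
  exact: is_formN h2.
apply: is_form_ext (fun x => esym (E' x j)) _.
exact: (is_vformZ h1 hk).
Qed.

Lemma coparamZ c x : coparam (c *: x) = c ^+ (1 + d * 2 + 2) *: coparam x.
Proof. exact: (is_vform_homog c x is_vform_coparam). Qed.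

Lemma X_good_form : is_form (2 + (d + d.+1) * 2 + (1 + d * 2)) X_good.
Proof.
have hk := @is_vform_kervec k.
apply: is_formM; last first.
  exact: is_form_wedge (@is_vform_id k 4) (is_vform_comp hs1 hk).
apply: is_formM; first exact: hk.
exact: (is_form_comp (is_form_wedge hs1 hs2) hk).
Qed.

Lemma P3_good_form : is_form (1 + (d + d.+1) * 1 + 2 * (1 + d)) P3_good.
Proof.
apply: is_formM; last exact: (is_vform_comp (@is_vform_kervec k) is_vform_param).
apply: is_formM; first exact: (is_vform_dsubmx (inord 2)).
exact: (is_form_comp (is_form_wedge hs1 hs2) is_vform_dsubmx).
Qed.

Lemma param_ker y : hankel (param y) *m dsubmx y = 0.
Proof. by apply: hankel_kerD => //; exact: hankel_kerZ. Qed.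

Lemma wedge_params y :
  wedge (param y) (s1 (dsubmx y)) = - wedge (s1 (dsubmx y)) (s2 (dsubmx y)) /\
  wedge (param y) (s2 (dsubmx y)) =
    y 0 0 * wedge (s1 (dsubmx y)) (s2 (dsubmx y)).
Proof.
rewrite !wedgeDl !wedgeZl !wedgexx mulr0 add0r addr0; split=> //.
exact: wedgeC.
Qed.

Lemma param_chordal y : P3_good y != 0 -> param y \in chordal_cubic k.
Proof.
rewrite !mulf_eq0 !negb_or -andbA => /and3P[v2 Dv _].
apply/chordal_cubicP; split; last first.
  by exists (dsubmx y); [exact: hcoord_neq0 v2 | exact: param_ker].
apply: contraNneq Dv => p0; have [+ _] := wedge_params y.
by rewrite p0 /wedge !hcoord0 !mul0r subr0 => /eqP; rewrite eq_sym oppr_eq0.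
Qed.

Lemma coparam_neq0 x : X_good x != 0 -> coparam x != 0.
Proof.
rewrite !mulf_eq0 !negb_or -andbA => /and3P[v2 _ w1].
apply: contraNneq (mulf_neq0 w1 v2) => /(congr1 dsubmx).
by rewrite /coparam col_mxKd linear0 -hcoordZ => ->; rewrite hcoord0.
Qed.

Lemma coparamK x : x \in chordal_cubic k -> X_good x != 0 ->
  exists2 c, c != 0 & param (coparam x) = c *: x.
Proof.
move=> Xx; rewrite !mulf_eq0 !negb_or -andbA => /and3P[v2 Dv w1].
have Hx := kervec_ker Xx v2; set v := kervec x in v2 Dv w1 Hx.
exists (- (wedge x (s1 v) ^+ d * wedge (s1 v) (s2 v))).
  by rewrite oppr_eq0 mulf_neq0 ?expf_neq0.
rewrite /param /coparam -/v col_mxKd.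
rewrite (is_vform_homog _ _ hs1) (is_vform_homog _ _ hs2).
have -> : col_mx (- wedge x (s2 v))%:M (wedge x (s1 v) *: v) 0 0 = - wedge x (s2 v).
  have -> : 0 = lshift 3 0 :> 'I_(1 + 3) by apply: val_inj.
  by rewrite col_mxEu mxE eqxx mulr1n.
rewrite [RHS]scaleNr -[in RHS]scalerA.
rewrite (secant_line_basis v2 Hx (s1_ker v) (s2_ker v)).
rewrite (wedgeC (s1 v)).
by apply/colP=> j; rewrite exprSr !mxE; ring.
Qed.

Lemma paramK y : P3_good y != 0 ->
  exists2 c, c != 0 & coparam (param y) = c *: y.
Proof.
rewrite !mulf_eq0 !negb_or -andbA => /and3P[v2 Dv k2].
have Ek := kervec_colinear (param_ker y) v2.
have [w1 w2] := wedge_params y.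
set v := dsubmx y in v2 Dv Ek w1 w2; set c := _ / _ in Ek.
have c0 : c != 0 by rewrite mulf_neq0 ?invr_eq0.
exists (- (c ^+ d.+1 * wedge (s1 v) (s2 v))).
  by rewrite oppr_eq0 mulf_neq0 ?expf_neq0.
rewrite /coparam Ek (is_vform_homog _ _ hs1) (is_vform_homog _ _ hs2).
rewrite !wedgeZr w1 w2 -[in RHS](vsubmxK y) scale_col_mx -/v.
congr col_mx; last by rewrite scalerA; congr (_ *: _); rewrite exprSr; ring.
apply/matrixP=> a b; rewrite !ord1 !mxE eqxx mulr1n.
have -> : lshift 3 0 = 0 :> 'I_(1 + 3) by apply: val_inj.
by ring.
Qed.

(** Both kernel vectors and coordinates in the basis [s1 v, s2 v] are transported
    by [g]; since [wedge] is not invariant, its values are all multiplied by the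
    same factor [e]. *)
Lemma coparam_equivariant g x : x \in chordal_cubic k -> X_good x != 0 ->
    X_good (sigma g *m x) != 0 ->
  exists2 c, c != 0 & coparam (sigma g *m x) = c *: (ext_repr g *m coparam x).
Proof.
have scale_ext c (t : 'M_1) (v : 'cV_3) :
    c *: (ext_repr g *m col_mx t v) = col_mx (c *: t) (c *: (rho g *m v)).
  by rewrite ext_reprE; have := scale_col_mx c t (rho g *m v); exact.
move=> Xx; rewrite !mulf_eq0 !negb_or -!andbA.
move=> /and3P[v2 Dv w1] /and3P[v2' Dv' w1'].
have Hx := kervec_ker Xx v2; have Hx' := rho_sigma g Hx.
have B := secant_line_basis v2 Hx (s1_ker _) (s2_ker _).
set x' := _ *m x in v2' Dv' w1' Hx' *; set v := kervec x in v2 Dv w1 Hx Hx' B *.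
set w := rho g *m v in Hx'.
have w2 : hcoord w 2 != 0.
  have Ew := kervecE Hx'; apply: contraNneq v2' => w2.
  move: Ew; rewrite w2 scale0r => /eqP.
  rewrite scaler_eq0 => /orP[/eqP-> //|/eqP E].
  case/eqP: (hcoord_neq0 v2).
  by rewrite -[v](mulKmx (repr_mx_unit rho (in_setT g))) -/w E mulmx0.
have Ew := kervec_colinear Hx' w2; set c := _ / _ in Ew.
have c0 : c != 0 by rewrite mulf_neq0 ?invr_eq0.
have Bg : wedge (s1 v) (s2 v) *: x' =
    wedge x (s2 v) *: s1 w + wedge (s1 v) x *: s2 w.
  by rewrite scalemxAr B mulmxDr -!scalemxAr s1_eqv s2_eqv.
have Dw : wedge (s1 w) (s2 w) != 0.
  move: Dv'; rewrite Ew (is_vform_homog _ _ hs1) (is_vform_homog _ _ hs2).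
  by apply: contraNneq; rewrite wedgeZl wedgeZr => ->; rewrite !mulr0.
pose e := wedge (s1 w) (s2 w) / wedge (s1 v) (s2 v).
have W1 : wedge x' (s1 w) = e * wedge x (s1 v).
  apply: (mulfI Dv); rewrite -[LHS]wedgeZl Bg wedgeDl !wedgeZl wedgexx mulr0 add0r.
  rewrite /e mulrA mulrCA divff // mulr1 (wedgeC (s1 v)) (wedgeC (s2 w)).
  by rewrite mulrNN mulrC.
have W2 : wedge x' (s2 w) = e * wedge x (s2 v).
  apply: (mulfI Dv); rewrite -[LHS]wedgeZl Bg wedgeDl !wedgeZl wedgexx mulr0 addr0.
  by rewrite /e mulrA mulrCA divff // mulr1 mulrC.
exists (c ^+ d.+1 * e).
  by rewrite !mulf_neq0 ?expf_neq0 ?invr_eq0.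
rewrite /coparam Ew (is_vform_homog _ _ hs1) (is_vform_homog _ _ hs2).
rewrite scale_ext !wedgeZr W1 W2 -/v -scalemxAr -/w; congr col_mx.
  apply/matrixP=> a b; rewrite !ord1 !mxE eqxx !mulr1n.
  by ring.
by rewrite !scalerA; congr (_ *: _); rewrite exprSr; ring.
Qed.

Variable v0 : 'cV[k]_3.
Hypotheses (v02 : hcoord v0 2 != 0) (s20 : hcoord (s2 v0) 0 = 0).
Hypothesis s1s2 : hcoord (s1 v0) 0 * hcoord (s2 v0) 1 != 0.

(** The point [s2 v0] is the image under [param] of [(0, v0)]. *)
Lemma X_good_neq0 : s2 v0 \in chordal_cubic k /\ X_good (s2 v0) != 0.
Proof.
have [n1 n2] : hcoord (s1 v0) 0 != 0 /\ hcoord (s2 v0) 1 != 0.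
  by apply/andP; rewrite -negb_or -mulf_eq0.
have k2 : hcoord (kervec (s2 v0)) 2 != 0.
  by rewrite hcoord_vec //= s20 mul0r sub0r oppr_eq0 mulf_neq0.
have D0 : wedge (s1 v0) (s2 v0) != 0 by rewrite /wedge s20 mulr0 subr0.
split.
  apply/chordal_cubicP; split; first exact: hcoord_neq0 n2.
  by exists v0 => //; exact: hcoord_neq0 v02.
have Ek := kervec_colinear (s2_ker v0) v02.
have c0 : hcoord (kervec (s2 v0)) 2 / hcoord v0 2 != 0.
  by rewrite mulf_neq0 ?invr_eq0.
rewrite /X_good mulf_neq0 ?mulf_neq0 // Ek (is_vform_homog _ _ hs1).
  by rewrite (is_vform_homog _ _ hs2) wedgeZl wedgeZr !mulf_neq0 // expf_neq0.
by rewrite wedgeZr wedgeC !mulf_neq0 ?oppr_eq0 // expf_neq0.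
Qed.

Lemma P3_good_neq0 : exists y, P3_good y != 0.
Proof.
exists (col_mx 0 v0); rewrite /P3_good /param !col_mxKd.
have -> : col_mx (0 : 'cV[k]_1) v0 0 0 = 0.
  have -> : 0 = lshift 3 0 :> 'I_(1 + 3) by apply: val_inj.
  by rewrite col_mxEu mxE.
have [_] := X_good_neq0; rewrite !mulf_eq0 !negb_or scale0r add0r.
move=> /andP[/andP[-> _] _].
rewrite v02 /wedge s20 mulr0 subr0; move: s1s2.
by rewrite mulf_eq0 negb_or => ->.
Qed.

End Birational.

(** * The action on the chordal cubic *)

Section Assembly.
Variable k : closedFieldType.

Lemma same_pointI n c (x y : 'cV[k]_n.+1) :
  c != 0 -> y != 0 -> x = c *: y -> same_point x y.
Proof.
move=> c0 y0 ->; split; first by rewrite scaler_eq0 negb_or c0.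
by exists c^-1; rewrite ?invr_eq0 // scalerA mulVf // scale1r.
Qed.

Variables (G : finGroupType) (i : {multiplicative G -> PGL k 1}).
Hypothesis i_inj : injective i.

Definition quartic_repr :=
  lift_repr (quartic_mx1 k) (@quartic_mxM k) (@quartic_mxZ k) i.
Definition dual_conic_repr :=
  lift_repr (dual_conic_mx1 k) (@dual_conic_mxM k) (@dual_conic_mxZ k) i.

Lemma dual_conic_repr_faithful g :
  g != 1%g -> ~~ is_scalar_mx (dual_conic_repr g).
Proof.
apply: contra => /dual_conic_mx_faithful; rewrite reprK => ig.
by apply/eqP/i_inj; rewrite ig PGL_morph1.
Qed.

Lemma quartic_repr_sym_PGL g : exists2 c : k, c != 0 &
  GLval (repr (sym_PGL 4 (i g))) = c *: quartic_repr g.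
Proof.
have [c c0 ->] := repr_piP (MkGL (sym_mx_unit 4 (repr (i g)))).
set A := repr (i g); have dA : \det A != 0 by rewrite -unitfE; exact: (GLunit A).
exists (c * \det A ^+ 2); first by rewrite mulf_neq0 ?expf_neq0.
rewrite -[quartic_repr g]/(quartic_mx A) /= scalerA -mulrA divff ?mulr1 //.
by rewrite expf_neq0.
Qed.

End Assembly.

Theorem theorem5p1 (k : closedFieldType) (char0 : [pchar k]%R =i pred0)
    (G : finGroupType) (i : {multiplicative G -> PGL k 1})
    (i_inj : injective i) :
  linearizable 3 (chordal_cubic k) (sym_PGL 4 \o i).
Proof.
pose rho := dual_conic_repr i; pose sigma := quartic_repr i.
have faithful : forall g, g != 1%g -> ~~ is_scalar_mx (rho g).
  exact: dual_conic_repr_faithful.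
have rho_sigma g (x : 'cV[k]_5) (v : 'cV_3) :
    hankel x *m v = 0 -> hankel (sigma g *m x) *m (rho g *m v) = 0.
  exact: quartic_mx_ker.
have [d [s1 [s2 [v0 [[hs1 hs2] eqv ker [v02 s20] s1s2]]]]] :=
  equivariant_sections faithful rho_sigma.
have ker1 v : hankel (s1 v) *m v = 0 by case: (ker v).
have ker2 v : hankel (s2 v) *m v = 0 by case: (ker v).
have eqv1 g v : s1 (rho g *m v) = sigma g *m s1 v by case: (eqv g v).
have eqv2 g v : s2 (rho g *m v) = sigma g *m s2 v by case: (eqv g v).
have [Xp gp] := X_good_neq0 hs1 hs2 ker2 v02 s20 s1s2.
have [q gq] := P3_good_neq0 hs1 hs2 ker2 v02 s20 s1s2.
have genX := generically_irreducible (@irreducible_chordal_cubic k)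
  (X_good_form hs1 hs2) Xp gp.
have q0 : q \in projective_space k 3.
  apply: contraNneq gq => ->.
  rewrite /P3_good (_ : hcoord (dsubmx 0) 2 = 0) ?mul0r //.
  by rewrite linear0 hcoord0.
have genY := generically_irreducible (@irreducible_projective_space k 3)
  (P3_good_form hs1 hs2) q0 gq.
have [F hF EF] := vform_forms (is_vform_coparam hs1 hs2).
have [H hH EH] := vform_forms (is_vform_param hs1 hs2).
exists (ext_repr rho), F, H; split; first split.
- split; first by exists (1 + d * 2 + 2)%N.
  by apply: genX => x _ gx; rewrite EF inE; exact: coparam_neq0 gx.
- split; first by exists (1 + d)%N.
  by apply: genY => y _ gy; rewrite EH; exact: param_chordal.
- apply: genX => x Xx gx; rewrite EF EH.
  have [c c0 E] := coparamK hs1 hs2 ker1 ker2 Xx gx.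
  by apply: same_pointI c0 _ E; case/chordal_cubicP: Xx.
- apply: genY => y y0 gy; rewrite EF EH.
  have [c c0 E] := paramK hs1 hs2 ker1 ker2 gy.
  exact: same_pointI c0 y0 E.
move=> g.
have hg := is_form_comp (X_good_form hs1 hs2)
  (is_vform_mulmx (sigma g) (@is_vform_id k 4)).
(* Equivariance holds at x when x and its image under g are both good. *)
pose x' := sigma g^-1%g *m s2 v0.
have Ex' : sigma g *m x' = s2 v0.
  by rewrite /x' mulmxA -repr_mxM ?in_setT // mulgV repr_mx1 mul1mx.
have Xx' : x' \in chordal_cubic k.
  case/chordal_cubicP: Xp => p0 [v v_0 Hv].
  apply/chordal_cubicP; split.
    by apply: contraNneq p0 => x'0; rewrite -Ex' x'0 mulmx0.
  exists (rho g^-1%g *m v); last exact: rho_sigma.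
  apply: contraNneq v_0 => E.
  by rewrite -[v](mulKmx (repr_mx_unit rho (in_setT g^-1%g))) E mulmx0.
have [|x'' Xx'' gg] :=
  irreducible_chordal_cubic (X_good_form hs1 hs2) hg Xp gp Xx' _.
  by rewrite Ex'.
apply: (generically_irreducible (@irreducible_chordal_cubic k)
  (is_formM (X_good_form hs1 hs2) hg) Xx'').
  by rewrite mulf_neq0 //; case/andP: gg.
move=> x Xx; rewrite mulf_eq0 negb_or => /andP[gx ggx].
have [c c0 E] :=
  coparam_equivariant rho_sigma hs1 hs2 eqv1 eqv2 ker1 ker2 Xx gx ggx.
have [a a0 Ea] := quartic_repr_sym_PGL i g.
have [b b0 Eb] := repr_piP (MkGL (repr_mx_unitr (ext_repr rho) (in_setT g))).
rewrite !EF [GLval _]Ea -[linear_action _ g]/(\pi_(PGL k 3) _).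
rewrite [X in X *m coparam _ _ _]Eb.
rewrite -(scalemxAl a) -(scalemxAl b) (coparamZ hs1 hs2) E.
have U : ext_repr rho g *m coparam s1 s2 x != 0.
  apply: contraNneq (coparam_neq0 gx) => E0.
  have uR := repr_mx_unit (ext_repr rho) (in_setT g).
  by rewrite -[coparam _ _ x](mulKmx uR) E0 mulmx0.
apply: (@same_pointI k _ (a ^+ (1 + d * 2 + 2) * c / b)).
- by rewrite !mulf_neq0 ?invr_eq0 ?expf_neq0.
- by rewrite scaler_eq0 negb_or b0.
by rewrite !scalerA -mulrA mulVf // mulr1.
Qed.
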